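(* Let $(H_n,K_n)_n\subset\mathcal{K}(\overline\Omega)\times\mathcal{K}(\overline\Omega)$ be a sequence such that $\mathsf{h}(H_n,H)\to0$ and $\mathsf{h}(K_n,K)\to0$ as $n\to\infty$, with $H,K\in\mathcal{K}(\overline\Omega)$. Suppose that the number of connected components of $K_n$ disjoint from $H_n$ is uniformly bounded with respect to $n\in\mathbb{N}$. Then $$\mathcal{H}^1\big((K\setminus H)\cap U\big)\le\liminf_{n\to\infty}\mathcal{H}^1\big((K_n\setminus H_n)\cap U\big)$$ for every open set $U\subset\Omega$.
   Context: $\Omega\subset\mathbb{R}^2$ is a bounded connected open set with Lipschitz boundary. $\mathcal{H}^1$ is the one-dimensional Hausdorff measure. $\mathcal{K}(\overline\Omega)$ is the set of all compact subsets of $\overline\Omega$ (including $\emptyset$), with the Hausdorff distance $\mathsf{h}(H,K)=\max\{\sup_{x\in H}\mathrm{dist}(x,K),\sup_{y\in K}\mathrm{dist}(y,H)\}$, where $\mathrm{dist}(x,\emptyset)=\mathrm{diam}(\Omega)$ and $\sup\emptyset=0$. *)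

(* Defs.v *)
From HB Require Import structures.
From mathcomp Require Import all_boot all_order all_algebra.
From mathcomp Require Import all_classical all_reals all_analysis.

Set Implicit Arguments.
Unset Strict Implicit.
Unset Printing Implicit Defensive.

Import Order.TTheory GRing.Theory Num.Theory.
Import numFieldNormedType.Exports.

Local Open Scope classical_set_scope.
Local Open Scope ring_scope.

(* The library norm on 'rV[R]_n is the sup norm: it induces the usual topology
   and the usual bounded sets, but metric quantities (diameters, distances,
   Hausdorff measure) must use the Euclidean norm below. *)
Definition enorm (R : realType) (n : nat) (v : 'rV[R]_n) : R :=
  Num.sqrt (\sum_(i < n) v ord0 i ^+ 2).

(* Inserting 0 only changes the supremum for A = set0, where it gives
   diam set0 = 0 instead of -oo. *)
Definition diam (R : realType) (n : nat) (A : set 'rV[R]_n) : \bar R :=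
  ereal_sup (0%E |` [set (enorm (x - y))%:E | x in A & y in A]).

(* H^1_delta.  In dimension one the normalising factor
   omega_1 2^(-1) (diam A)^1, with omega_1 = 2 the length of ]-1, 1[, is just
   diam A. *)
Definition hausdorff1_delta (R : realType) (n : nat) (delta : R)
    (A : set 'rV[R]_n) : \bar R :=
  ereal_inf [set (\sum_(0 <= i <oo) diam (F i))%E
    | F in [set F : nat -> set 'rV[R]_n |
             (forall i, (diam (F i) <= delta%:E)%E) /\ A `<=` \bigcup_i F i]].

(* H^1_delta is nonincreasing in delta, so its limit as delta tends to 0+ is
   this supremum. *)
Definition hausdorff1 (R : realType) (n : nat) (A : set 'rV[R]_n) : \bar R :=
  ereal_sup [set hausdorff1_delta delta A | delta in [set delta : R | 0 < delta]].

(* Up to an orthogonal change of coordinates, Omega is near each of its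
   boundary points the strict epigraph of a Lipschitz function. *)
Definition lipschitz_boundary (R : realType) (Omega : set 'rV[R]_2) : Prop :=
  forall x, (closure Omega `\` interior Omega) x ->
    exists (Q : 'M[R]_2) (gamma : R -> R),
      [/\ Q *m Q^T = 1%:M,
          lipschitz gamma
        & \forall y \near x,
            Omega y <-> gamma ((y *m Q) ord0 ord0) < (y *m Q) ord0 ord_max].

Definition compact_subsets (T : topologicalType) (X : set T) : set (set T) :=
  [set K | compact K /\ K `<=` X].

Definition dist (R : realType) (Omega : set 'rV[R]_2) (x : 'rV[R]_2)
    (K : set 'rV[R]_2) : R :=
  if K == set0 then fine (diam Omega) else inf [set enorm (x - y) | y in K].

(* Meant for H, K included in the closure of a bounded Omega, so that the two
   suprema are those of bounded sets; the library has sup set0 = 0. *)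
Definition hdist (R : realType) (Omega : set 'rV[R]_2)
    (H K : set 'rV[R]_2) : R :=
  Num.max (sup [set dist Omega x K | x in H])
          (sup [set dist Omega y H | y in K]).

Definition components_disjoint_from (T : topologicalType) (K H : set T) :
    set (set T) :=
  [set C | (exists2 x, K x & C = connected_component K x) /\ C `&` H = set0].

(* Main.v *)
Require Import Defs.
From HB Require Import structures.
From mathcomp Require Import all_boot all_order all_algebra.
From mathcomp Require Import all_classical all_reals all_analysis.
From mathcomp Require Import ring lra zify.

Set Implicit Arguments.
Unset Strict Implicit.
Unset Printing Implicit Defensive.

Import Order.TTheory GRing.Theory Num.Theory.
Import numFieldNormedType.Exports.

Local Open Scope classical_set_scope.
Local Open Scope ring_scope.

(** This is Golab's lower semicontinuity theorem, localised away from H.  It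
    rests on a concentration property of the sets K_n and a covering argument.

    Concentration ([hausdorff1_disc_ge]).  Let C be closed and connected, x a
    point of C, and suppose that C leaves the ball of radius r around x.  If C
    has finite length near x, it contains an injective Lipschitz curve from x to
    a point at distance at least r: chains in C with small steps and not too many
    points converge to Lipschitz curves, and one with the least Lipschitz
    constant has no loop, since cutting a loop off would lower the constant.  Let
    p be a point of the curve at distance r/2 from x.  Both ends of the curve lie at distance at
    least r/2 from p, so two disjoint arcs join p to the boundary of the disc of
    centre p and radius r/2, and C has length at least r, the diameter of that
    disc, inside it.

    Passage to the limit.  A number c above the inferior limit bounds the length
    of K_n outside H_n in U for the indices n of some ultrafilter, along which
    every bounded sequence converges.  Let x in K outside H, in U, be such that
    the components of K_n at points tending to x do not shrink to x.
    Concentration gives discs in K_n near x at every small scale, and their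
    limits are discs, as small and as close to x as wanted, that carry for most
    n a length of K_n at least their diameter, up to a factor theta > 1
    ([charged_fine]).  Discs at positive distance from each other have diameters
    of sum at most theta c ([charged_sum]), and Vitali's covering argument turns
    this bound on separated discs into a bound on the Hausdorff measure of the
    set of these x ([vitali_hausdorff1]).  At the remaining points whole
    components of K_n shrink; these components end up disjoint from H_n and from
    each other, so that the bound on their number makes these points finitely
    many ([finite_not_persistent]), and a finite set has length zero. *)

(** * The Euclidean norm and limits along ultrafilters *)

Section EuclideanNorm.
Context {R : realType} {n : nat}.
Implicit Types u v w x y z : 'rV[R]_n.

Local Notation dot u v := (\sum_(i < n) u ord0 i * v ord0 i).

Lemma enorm_ge0 v : 0 <= enorm v.
Proof. exact: sqrtr_ge0. Qed.

Let dot_ge0 v : 0 <= dot v v.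
Proof. by apply: sumr_ge0 => i _; rewrite -expr2 sqr_ge0. Qed.

Let enorm_sqr v : enorm v ^+ 2 = dot v v.
Proof. by rewrite /enorm sqr_sqrtr ?dot_ge0. Qed.

Let cauchy_schwarz u v : dot u v <= enorm u * enorm v.
Proof.
apply: (le_trans (ler_norm _)).
rewrite -(@ler_pXn2r _ 2)// ?nnegrE ?mulr_ge0 ?enorm_ge0//.
rewrite exprMn !enorm_sqr real_normK ?num_real//.
set a := dot u u; set b := dot v v; set c := dot u v.
have [b0|b_gt0] := leP b 0.
  have b_eq0 : b = 0 by apply/eqP; rewrite eq_le b0 dot_ge0.
  have v0 i : v ord0 i = 0.
    have := b_eq0; rewrite /b => /psumr_eq0P H.
    apply/eqP; rewrite -sqrf_eq0 expr2 H// => j _.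
    by rewrite -expr2 sqr_ge0.
  rewrite b_eq0 mulr0 /c big1 ?expr0n// => i _.
  by rewrite v0 mulr0.
have : 0 <= dot (b *: u - c *: v) (b *: u - c *: v) by exact: dot_ge0.
have -> s t : dot (s *: u - t *: v) (s *: u - t *: v) =
    s ^+ 2 * a - s * t * 2 * c + t ^+ 2 * b.
  rewrite !mulr_sumr -sumrB -big_split /=.
  by apply: eq_bigr => i _; rewrite !mxE; ring.
move=> H; rewrite -subr_ge0 -(pmulr_rge0 _ b_gt0).
by rewrite (le_trans H)// le_eqVlt; apply/orP; left; apply/eqP; ring.
Qed.

Lemma enormD u v : enorm (u + v) <= enorm u + enorm v.
Proof.
rewrite -(@ler_pXn2r _ 2)// ?nnegrE ?addr_ge0 ?enorm_ge0// enorm_sqr.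
rewrite (_ : dot _ _ = dot u u + dot u v * 2 + dot v v); last first.
  by rewrite mulr_suml -!big_split /=; apply: eq_bigr => i _; rewrite !mxE; ring.
rewrite sqrrD !enorm_sqr lerD2r lerD2l -[leRHS]mulr_natr ler_pM2r// cauchy_schwarz.
Qed.

Lemma enormN v : enorm (- v) = enorm v.
Proof. by rewrite /enorm; congr Num.sqrt; apply: eq_bigr => i _; rewrite mxE sqrrN. Qed.

Lemma enorm0 : enorm (0 : 'rV[R]_n) = 0.
Proof. by rewrite /enorm big1 ?sqrtr0// => i _; rewrite mxE expr0n. Qed.

Lemma enorm_distC x y : enorm (x - y) = enorm (y - x).
Proof. by rewrite -enormN opprB. Qed.

Lemma enorm_triangle y x z : enorm (x - z) <= enorm (x - y) + enorm (y - z).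
Proof. by rewrite (le_trans _ (enormD _ _))// addrA subrK. Qed.

Lemma coord_le_enorm v i : `|v ord0 i| <= enorm v.
Proof.
rewrite -sqrtr_sqr ler_wsqrtr// (bigD1 i)//= lerDl.
by apply: sumr_ge0 => j _; rewrite sqr_ge0.
Qed.

Lemma enorm_eq0 v : enorm v = 0 -> v = 0.
Proof.
move=> v0; apply/rowP => i; apply/eqP; rewrite mxE -normr_le0 -v0.
exact: coord_le_enorm.
Qed.

Lemma norm_le_enorm v : `|v| <= enorm v.
Proof.
rewrite [leLHS]/Num.Def.normr/= mx_normrE; apply/bigmax_leP; split; first exact: enorm_ge0.
by move=> [i j] _ /=; rewrite (ord1 i) coord_le_enorm.
Qed.

Lemma enorm_le_norm v : enorm v <= Num.sqrt n%:R * `|v|.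
Proof.
rewrite -[X in _ * X]ger0_norm// -sqrtr_sqr -sqrtrM// ler_wsqrtr//.
rewrite (@le_trans _ _ (\sum_(i < n) `|v| ^+ 2))//.
  apply: ler_sum => i _; rewrite -[leLHS]real_normK ?num_real//.
  rewrite ler_pXn2r ?nnegrE// [leRHS]/Num.Def.normr/= mx_normrE.
  by apply: (le_trans _ (le_bigmax_cond _ (fun ij => `|v ij.1 ij.2|) (j := (ord0, i)) _)).
by rewrite sumr_const card_ord -[leLHS]mulr_natl.
Qed.


Lemma enormZ (a : R) v : enorm (a *: v) = `|a| * enorm v.
Proof.
rewrite /enorm -sqrtr_sqr -sqrtrM ?sqr_ge0// mulr_sumr; congr Num.sqrt.
by apply: eq_bigr => i _; rewrite mxE exprMn.
Qed.

Lemma bounded_enorm (A : set 'rV[R]_n) : bounded_set A ->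
  exists M, forall x, A x -> enorm x <= M.
Proof.
move=> [M [_ AM]]; exists (Num.sqrt n%:R * (M + 1)) => x Ax.
rewrite (le_trans (enorm_le_norm x))// ler_wpM2l//.
by apply: (AM (M + 1)) => //; rewrite ltrDl.
Qed.

Lemma near_enorm x (e : R) : 0 < e -> \forall y \near x, enorm (y - x) < e.
Proof.
move=> e0; have s0 : 0 < Num.sqrt n%:R + 1 :> R by rewrite ltr_wpDl.
apply/nbhs_ballP; exists (e / (Num.sqrt n%:R + 1)); first by rewrite /= divr_gt0.
move=> y; rewrite -ball_normE /= distrC ltr_pdivlMr// => yx.
apply: le_lt_trans yx; rewrite (le_trans (enorm_le_norm _))// mulrC.
by rewrite ler_wpM2l// lerDl.
Qed.

Lemma open_enorm (U : set 'rV[R]_n) x : open U -> U x ->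
  exists2 e, 0 < e & forall y, enorm (y - x) <= e -> U y.
Proof.
rewrite openE => oU /oU /nbhs_ballP[e /= e0 eU].
exists (e / 2); first by rewrite divr_gt0.
move=> y yx; apply: eU; rewrite -ball_normE /= distrC.
rewrite (le_lt_trans (norm_le_enorm _))// (le_lt_trans yx)//.
by rewrite ltr_pdivrMr// ltr_pMr// ltr1n.
Qed.

Lemma closed_enorm (A : set 'rV[R]_n) x : closed A ->
  (forall e, 0 < e -> exists2 y, A y & enorm (y - x) < e) -> A x.
Proof.
move=> cA xA; apply: contrapT => nAx.
have [e e0 eA] := open_enorm (closed_openC cA) nAx.
by have [y Ay /ltW/eA] := xA _ e0.
Qed.

End EuclideanNorm.

Section UltraLimit.
Context {T : Type} (W : set_system T) {UW : UltraFilter W}.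

Let fmap_ultra (S : Type) (f : T -> S) : UltraFilter (f @ W).
Proof.
split=> [|G GP fWG]; first exact: fmap_proper_filter.
rewrite predeqE => A; split=> [GA|]; last exact: fWG.
have [//|/(fWG (~` A)) GnA] := in_ultra_setVsetC (f @^-1` A) UW.
by have /filter_ex[? []] : G (A `&` ~` A) by exact: filterI.
Qed.

(** Limits along one fixed ultrafilter make subsequences unnecessary: the limits
    of arbitrarily many bounded sequences exist simultaneously. *)
Lemma ultra_limit_enorm (R : realType) n (f : T -> 'rV[R]_n) a (M : R) :
  (\forall t \near W, enorm (f t - a) <= M) ->
  exists p, forall e, 0 < e -> \forall t \near W, enorm (f t - p) < e.
Proof.
move=> fM.
pose A (i : 'I_n) := `[a ord0 i - M, a ord0 i + M]%classic.
have := @compact_ultra 'rV[R]_n; rewrite predeqE.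
move=> /(_ [set v | forall i, A i (v ord0 i)])[+ _].
move=> /(_ (rV_compact (fun i => @segment_compact _ _ _)))/(_ _ (fmap_ultra f)).
move=> [|p [_ fp]]; last by exists p => e /(near_enorm p)/fp.
apply: filterS fM => t ftM i; rewrite /A /= in_itv /= -ler_distl.
by have := coord_le_enorm (f t - a) i; rewrite !mxE => /le_trans; exact.
Qed.

Lemma ultra_limit_real (R : realType) (f : T -> R) (a b : R) :
  (\forall t \near W, a <= f t <= b) ->
  exists2 p, a <= p <= b & forall e, 0 < e -> \forall t \near W, `|f t - p| < e.
Proof.
move=> fab; have cA := @segment_compact _ a b.
have := @compact_ultra R; rewrite predeqE => /(_ `[a, b]%classic)[/(_ cA) + _].
move=> /(_ _ (fmap_ultra f))[|p [+ fp]].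
  by apply: filterS fab => t; rewrite /= in_itv.
rewrite /= in_itv => pab; exists p => // e e0.
apply: (@filterS _ W _ (f @^-1` ball p e)); last exact/fp/nbhsx_ballx.
by move=> t /=; rewrite -ball_normE/= distrC.
Qed.

End UltraLimit.

(** * Hausdorff measure: separated pieces and projections *)

Section Diameter.
Context {R : realType} {n : nat}.
Implicit Types (A B : set 'rV[R]_n) (p x y : 'rV[R]_n).
Local Open Scope ereal_scope.

Definition disc p (r : R) : set 'rV[R]_n := [set y | enorm (y - p) <= r]%R.

Lemma diam_ge0 A : 0 <= diam A.
Proof. by apply: ereal_sup_ubound; left. Qed.

Lemma diam_ub A x y : A x -> A y -> (enorm (x - y))%:E <= diam A.
Proof. by move=> Ax Ay; apply: ereal_sup_ubound; right; exists x => //; exists y. Qed.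

Lemma diam_le A (d : R) : (0 <= d)%R ->
  (forall x y, A x -> A y -> enorm (x - y) <= d)%R -> diam A <= d%:E.
Proof.
move=> d0 Ad; apply: ge_ereal_sup => _ [->|[x Ax [y Ay <-]]]; rewrite lee_fin//.
exact: Ad.
Qed.

Lemma diam_subset A B : A `<=` B -> diam A <= diam B.
Proof.
move=> AB; apply: ge_ereal_sup => _ [->|[x Ax [y Ay <-]]]; first exact: diam_ge0.
by apply: diam_ub; exact: AB.
Qed.

Lemma diam_set0 : diam (set0 : set 'rV[R]_n) = 0.
Proof. by apply/eqP; rewrite eq_le diam_ge0 andbT; apply: diam_le. Qed.

Lemma diam_set1 x : diam [set x] = 0.
Proof.
apply/eqP; rewrite eq_le diam_ge0 andbT; apply: diam_le => // _ _ -> ->.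
by rewrite subrr enorm0.
Qed.

Lemma diam_disc p (r : R) : (0 <= r)%R -> diam (disc p r) <= (2 * r)%:E.
Proof.
move=> r0; apply: diam_le => [|x y xp yp]; first by rewrite mulr_ge0.
rewrite (le_trans (enorm_triangle p _ _))// (enorm_distC p) mulrDl mul1r.
exact: lerD.
Qed.

End Diameter.

Lemma ereal_supD_le (R : realType) (S T : set (\bar R)) (c : \bar R) :
  S !=set0 -> T !=set0 -> (forall a, S a -> 0 <= a)%E ->
  (forall b, T b -> 0 <= b)%E -> (forall a b, S a -> T b -> a + b <= c)%E ->
  (ereal_sup S + ereal_sup T <= c)%E.
Proof.
move=> [a0 Sa0] [b0 Tb0] S0 T0 STc.
have [->|cy] := eqVneq c +oo%E; first by rewrite leey.
have ac a : S a -> (a <= c)%E.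
  by move=> Sa; rewrite (le_trans _ (STc _ _ Sa Tb0))// leeDl// T0.
have bc b : T b -> (b <= c)%E.
  by move=> Tb; rewrite (le_trans _ (STc _ _ Sa0 Tb))// leeDr// S0.
have cfin : c \is a fin_num.
  by rewrite ge0_fin_numE ?ltey//; exact: le_trans (S0 _ Sa0) (ac _ Sa0).
have bfin b : T b -> b \is a fin_num.
  move=> Tb; rewrite ge0_fin_numE ?T0// (le_lt_trans (bc _ Tb))//.
  by rewrite ltey.
have Sfin : ereal_sup S \is a fin_num.
  rewrite ge0_fin_numE; last by apply: le_ereal_sup_tmp; exists a0 => //; exact: S0.
  by rewrite (@le_lt_trans _ _ c) ?ltey//; exact: ge_ereal_sup.
rewrite -leeBrDl//; apply: ge_ereal_sup => b Tb.
rewrite leeBrDl// -leeBrDr ?bfin//; apply: ge_ereal_sup => a Sa.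
by rewrite leeBrDr ?bfin// STc.
Qed.

Section Hausdorff.
Context {R : realType} {n : nat}.
Implicit Types (A B : set 'rV[R]_n) (delta : R).
Local Open Scope ereal_scope.

Lemma hausdorff1_delta_le delta A (F : nat -> set 'rV[R]_n) :
  (forall i, diam (F i) <= delta%:E) -> A `<=` \bigcup_i F i ->
  hausdorff1_delta delta A <= \sum_(0 <= i <oo) diam (F i).
Proof. by move=> Fd AF; apply: ereal_inf_lbound; exists F. Qed.

Lemma hausdorff1_delta_ge0 delta A : 0 <= hausdorff1_delta delta A.
Proof.
apply: le_ereal_inf_tmp => _ [F _ <-].
by apply: nneseries_ge0 => i _ _; exact: diam_ge0.
Qed.

Lemma le_hausdorff1_delta delta A B : A `<=` B ->
  hausdorff1_delta delta A <= hausdorff1_delta delta B.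
Proof.
move=> AB; apply: ereal_inf_le_tmp => _ [F [Fd BF] <-]; exists F => //.
by split=> //; exact: subset_trans BF.
Qed.

Lemma hausdorff1_delta_anti delta delta' A : (delta <= delta')%R ->
  hausdorff1_delta delta' A <= hausdorff1_delta delta A.
Proof.
move=> dd; apply: ereal_inf_le_tmp => _ [F [Fd BF] <-]; exists F => //.
by split=> // i; rewrite (le_trans (Fd i))// lee_fin.
Qed.

Lemma hausdorff1_ub delta A : (0 < delta)%R ->
  hausdorff1_delta delta A <= hausdorff1 A.
Proof. by move=> d0; apply: ereal_sup_ubound; exists delta. Qed.

Lemma hausdorff1_ge0 A : 0 <= hausdorff1 A.
Proof.
exact: le_trans (hausdorff1_delta_ge0 1 A) (hausdorff1_ub A (@ltr01 _)).
Qed.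

Lemma le_hausdorff1 A B : A `<=` B -> hausdorff1 A <= hausdorff1 B.
Proof.
move=> AB; apply: ge_ereal_sup => _ [d d0 <-].
by rewrite (le_trans _ (hausdorff1_ub B d0))//; exact: le_hausdorff1_delta.
Qed.

(** A set of diameter at most delta cannot meet both A and B, so that the traces
    on A and on B of a cover of the union have together at most its cost. *)
Lemma hausdorff1_delta_setU_far delta A B :
  (forall a b, A a -> B b -> delta < enorm (a - b))%R ->
  hausdorff1_delta delta A + hausdorff1_delta delta B <=
  hausdorff1_delta delta (A `|` B).
Proof.
move=> ABd; apply: le_ereal_inf_tmp => _ [F [Fd ABF] <-].
apply: (@le_trans _ _
    (\sum_(0 <= i <oo) (diam (F i `&` A) + diam (F i `&` B)))); last first.
  apply: lee_nneseries => [i _ _|i _]; first by rewrite adde_ge0 ?diam_ge0.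
  have [FA0|/set0P[a [Fa Aa]]] := eqVneq (F i `&` A) set0.
    by rewrite FA0 diam_set0 add0e; apply: diam_subset; exact: subIsetl.
  have [FB0|/set0P[b [Fb Bb]]] := eqVneq (F i `&` B) set0.
    by rewrite FB0 diam_set0 adde0; apply: diam_subset; exact: subIsetl.
  have := le_trans (diam_ub Fa Fb) (Fd i).
  by rewrite lee_fin leNgt ABd.
rewrite nneseriesD => [|i _ _|i _ _]; rewrite ?diam_ge0//.
have FI C i : diam (F i `&` C) <= delta%:E.
  by rewrite (le_trans _ (Fd i))//; apply: diam_subset; exact: subIsetl.
apply: leeD; apply: hausdorff1_delta_le => // x Cx.
- by have [|i _ Fx] := ABF x; [left|exists i].
- by have [|i _ Fx] := ABF x; [right|exists i].
Qed.

Lemma hausdorff1_setU_far (s : R) A B : (0 < s)%R ->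
  (forall a b, A a -> B b -> s <= enorm (a - b))%R ->
  hausdorff1 A + hausdorff1 B <= hausdorff1 (A `|` B).
Proof.
move=> s0 ABs; apply: ereal_supD_le.
- by exists (hausdorff1_delta 1 A), 1%R => //=.
- by exists (hausdorff1_delta 1 B), 1%R => //=.
- by move=> _ [d _ <-]; exact: hausdorff1_delta_ge0.
- by move=> _ [d _ <-]; exact: hausdorff1_delta_ge0.
move=> _ _ [d /= d0 <-] [e /= e0 <-].
pose t := Num.min (Num.min d e) (s / 2)%R.
have [td te] : (t <= d)%R /\ (t <= e)%R by rewrite /t !ge_min !lexx !orbT.
have ts : (t < s)%R.
  by rewrite /t gt_min ltr_pdivrMr// ltr_pMr// ltr1n orbT.
have t0 : (0 < t)%R by rewrite /t !lt_min d0 e0/= divr_gt0.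
apply: (@le_trans _ _ (hausdorff1_delta t A + hausdorff1_delta t B)).
  by apply: leeD; exact: hausdorff1_delta_anti.
apply: le_trans (hausdorff1_ub _ t0); apply: hausdorff1_delta_setU_far.
by move=> a b Aa Bb; exact: lt_le_trans ts (ABs _ _ Aa Bb).
Qed.

(** A disc is given by its centre and its radius.  The inequality says that the
    closed discs are disjoint, in a form that exhibits the gap between them. *)
Definition far_apart (d e : 'rV[R]_n * R) := (d.2 + e.2 < enorm (d.1 - e.1))%R.

Lemma exists_lower_bound (I : eqType) (g : I -> R) (s : seq I) :
  (forall i, i \in s -> 0 < g i)%R ->
  exists2 e, (0 < e)%R & (forall i, i \in s -> e <= g i)%R.
Proof.
elim: s => [|i s IHs] gs; first by exists 1%R.
have [j js|e e0 eg] := IHs; first by apply: gs; rewrite in_cons js orbT.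
exists (Num.min e (g i)); first by rewrite lt_min e0 gs// mem_head.
by move=> j; rewrite in_cons => /predU1P[->|/eg]; rewrite ge_min ?lexx ?orbT// => ->.
Qed.

(** The traces of A on the discs are positively separated, so that their measures
    add up for every set A, measurable or not. *)
Lemma sum_hausdorff1_discs A (s : seq ('rV[R]_n * R)) : pairwise far_apart s ->
  \sum_(d <- s) hausdorff1 (A `&` disc d.1 d.2) <= hausdorff1 A.
Proof.
elim: s A => [A _|d s IHs A /= /andP[/allP ds sep]].
  by rewrite big_nil hausdorff1_ge0.
pose B := A `&` [set y | exists2 e, e \in s & disc e.1 e.2 y].
have [e e0 es] : exists2 e, (0 < e)%R & forall f, f \in s ->
    (e <= enorm (d.1 - f.1) - (d.2 + f.2))%R.
  by apply: exists_lower_bound => f fs; rewrite subr_gt0; exact: ds.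
rewrite big_cons.
apply: (@le_trans _ _ (hausdorff1 (A `&` disc d.1 d.2) + hausdorff1 B)).
  apply: leeD => //; apply: le_trans (IHs B sep).
  rewrite big_seq [leRHS]big_seq; apply: lee_sum => f fs.
  by apply: le_hausdorff1 => y [Ay fy]; split => //; split => //; exists f.
apply: (@le_trans _ _ (hausdorff1 ((A `&` disc d.1 d.2) `|` B))); last first.
  by apply: le_hausdorff1; rewrite subUset; split; exact: subIsetl.
apply: (hausdorff1_setU_far e0) => a b [_ ad] [_ [f /es fe bf]].
have := enorm_triangle a d.1 f.1; have := enorm_triangle b a f.1.
by move: ad bf fe; rewrite /disc /= (enorm_distC d.1 a); lra.
Qed.

(** A 1-Lipschitz function maps each set of a cover of A into a segment no longer
    than its diameter, and these segments cover [a, b]. *)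
Lemma hausdorff1_ge_projection A (u : 'rV[R]_n -> R) (a b : R) :
  (forall x y, `|u x - u y| <= enorm (x - y))%R -> `[a, b]%classic `<=` u @` A ->
  (b - a)%:E <= hausdorff1 A.
Proof.
move=> u1 abA; apply: le_trans (hausdorff1_ub A (@ltr01 _)).
apply: le_ereal_inf_tmp => _ [F [Fd AF] <-].
have dE i : diam (F i) = (fine (diam (F i)))%:E.
  by rewrite fineK// ge0_fin_numE ?diam_ge0// (le_lt_trans (Fd i))// ltry.
pose I i := `[inf (u @` F i), sup (u @` F i)]%classic.
have uF i x y : F i x -> F i y -> (u x - u y <= fine (diam (F i)))%R.
  move=> Fx Fy; rewrite (le_trans (ler_norm _))// (le_trans (u1 _ _))//.
  by rewrite -lee_fin -dE; exact: diam_ub.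
have FI i x : F i x -> I i (u x).
  move=> Fx; rewrite /I /= in_itv /=; apply/andP; split.
    apply: ge_inf; last by exists x.
    exists (u x - fine (diam (F i)))%R => _ [y Fy <-].
    by rewrite lerBlDl -lerBlDr uF.
  apply: ub_le_sup; last by exists x.
  exists (u x + fine (diam (F i)))%R => _ [y Fy <-].
  by rewrite -lerBlDl uF.
have Isize i : lebesgue_measure (I i) <= diam (F i).
  rewrite lebesgue_measure_itv /=; case: ifPn => // _; last exact: diam_ge0.
  rewrite dE -EFinB lee_fin.
  have [->|/set0P[x Fx]] := eqVneq (F i) set0.
    by rewrite image_set0 sup0 inf0 subrr diam_set0.
  rewrite lerBlDr; apply: ge_sup; first by exists (u x), x.
  move=> _ [y Fy <-]; rewrite -lerBlDl; apply: lb_le_inf; first by exists (u x), x.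
  by move=> _ [z Fz <-]; rewrite lerBlDl -lerBlDr uF.
apply: (@le_trans _ _ (lebesgue_measure `[a, b]%classic)).
  rewrite lebesgue_measure_itv /= lte_fin -EFinB; case: ltP => // ba.
  by rewrite lee_fin subr_le0.
apply: (@le_trans _ _ (\sum_(0 <= i <oo) lebesgue_measure (I i))).
  apply: measure_sigma_subadditive => //.
    by move=> i; exact: measurable_itv.
  by move=> _ /abA[x /AF[i _ Fx] <-]; exists i => //; exact: FI.
by apply: lee_nneseries => // i _ _; exact: measure_ge0.
Qed.

End Hausdorff.
(** * Vitali covering by discs that need not contain the points they serve *)

Section VitaliCovering.
Context {R : realType} {n : nat}.
Local Notation V := 'rV[R]_n.
Implicit Types (A : set V) (d e : V * R) (s : seq (V * R)) (D : set (V * R)).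

Lemma nneseries_le_near (u : nat -> \bar R) (c : \bar R) N :
  (forall i, 0 <= u i)%E -> (forall K, (N <= K)%N -> \sum_(0 <= i < K) u i <= c)%E ->
  (\sum_(0 <= i <oo) u i <= c)%E.
Proof.
move=> u0 uc; apply: lime_le; first exact: is_cvg_nneseries.
by near=> K; apply: uc; near: K; exists N.
Unshelve. all: by end_near. Qed.

Lemma hausdorff1_delta_le_discs (delta : R) A (p : nat -> V) (c : nat -> R) (M : R) N :
  0 <= delta -> (forall i, 0 <= c i) -> (forall i, 2 * c i <= delta) ->
  (forall K, (N <= K)%N -> \sum_(0 <= i < K) 2 * c i <= M) ->
  A `<=` \bigcup_i disc (p i) (c i) ->
  (hausdorff1_delta delta A <= M%:E)%E.
Proof.
move=> d0 c0 cd cM Ac.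
apply: le_trans (hausdorff1_delta_le _ Ac) _ => [i|].
  by rewrite (le_trans (diam_disc _ (c0 i)))// lee_fin.
apply: (@nneseries_le_near _ _ N) => [i|K NK]; first exact: diam_ge0.
apply: (@le_trans _ _ (\sum_(0 <= i < K) (2 * c i)%:E)%E).
  by apply: lee_sum => i _; exact: diam_disc.
by rewrite sumEFin lee_fin cM.
Qed.

(** Discs of D are chosen one after the other, each far apart from the previous
    ones and with at least half of the largest radius then available.  The radii
    tend to 0 since the sum of the diameters is bounded.  A point x outside the
    first N chosen discs is served by some disc d far apart from them; d cannot
    stay available for ever, so it comes close to a later chosen disc, whose
    radius is at least half that of d.  Hence x lies in that disc enlarged 7
    times, and the enlarged discs of index at least N have a small sum.  The
    diameters in this cover are at most 14 rho. *)
Section Greedy.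
Variables (D : set (V * R)) (A : set V) (M rho : R).
Hypothesis rho_gt0 : 0 < rho.
Hypothesis D_gt0 : forall d, D d -> 0 < d.2 <= rho.
Hypothesis D_sum : forall s, (forall d, d \in s -> D d) -> pairwise far_apart s ->
  \sum_(d <- s) 2 * d.2 <= M.
Hypothesis D_fine : forall x (e : R), A x -> 0 < e ->
  exists d, [/\ D d, enorm (x - d.1) + d.2 <= e & enorm (x - d.1) <= 2 * d.2].

Let valid s := (forall d, d \in s -> D d) /\ pairwise far_apart s.
Let avail s d := D d /\ all (far_apart d) s.

Let valid_cons s d : valid s -> avail s d -> valid (d :: s).
Proof.
move=> [sD ss] [Dd ds]; split=> [e|]; last by rewrite /= ds.
by rewrite in_cons => /predU1P[->//|/sD].
Qed.

Let covered_or_avail s x : A x -> (exists2 d, d \in s & disc d.1 d.2 x) \/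
  exists2 d, avail s d & enorm (x - d.1) <= 2 * d.2.
Proof.
move=> Ax.
have [|xs] := pselect (exists2 d, d \in s & disc d.1 d.2 x); first by left.
right.
have [e e0 es] : exists2 e, 0 < e & forall d, d \in s ->
    e <= enorm (x - d.1) - d.2.
  apply: exists_lower_bound => d ds; rewrite subr_gt0 ltNge; apply/negP => dx.
  by apply: xs; exists d.
have [d [Dd dx xd]] := D_fine Ax (divr_gt0 e0 (@ltr0Sn _ 1)).
exists d => //; split=> //; apply/allP => f /es ef.
rewrite /far_apart; have := enorm_triangle d.1 x f.1.
by move: ef dx; lra.
Qed.

Let greedy_choice s : avail s !=set0 ->
  exists d, avail s d /\ forall e, avail s e -> e.2 <= 2 * d.2.
Proof.
move=> [d0 d0s]; pose E := [set d.2 | d in avail s].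
have supE : has_sup E.
  split; first by exists d0.2, d0.
  by exists rho => _ [d [/D_gt0/andP[_ ?] _] <-].
have d0E : d0.2 <= sup E by apply: ub_le_sup; [case: supE|exists d0].
have sup_gt0 : 0 < sup E.
  by apply: lt_le_trans d0E; have /andP[] := D_gt0 d0s.1.
have [_ [d ds <-] dE] := sup_adherent (divr_gt0 sup_gt0 (@ltr0Sn _ 1)) supE.
exists d; split => // e es.
have : e.2 <= sup E by apply: ub_le_sup; [case: supE|exists e].
by move: dE; lra.
Qed.

Let stuck_case s : valid s -> avail s = set0 ->
  (hausdorff1_delta (14 * rho) A <= M%:E)%E.
Proof.
move=> [sD ss] s0; pose z : V * R := (0, 0).
have rho0 : 0 <= rho by exact: ltW.
have nthD i : 0 <= (nth z s i).2 <= rho.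
  have [si|si] := ltnP i (size s); last by rewrite nth_default//= lexx.
  by have /andP[/ltW -> ->] := D_gt0 (sD _ (mem_nth z si)).
apply: (@hausdorff1_delta_le_discs _ _ (fun i => (nth z s i).1)
    (fun i => (nth z s i).2) _ (size s)).
- by rewrite mulr_ge0.
- by move=> i; have /andP[] := nthD i.
- by move=> i; have /andP[] := nthD i; lra.
- move=> K sK; rewrite (big_cat_nat (n := size s))//=.
  rewrite [X in _ + X]big_nat_cond [X in _ + X]big1 ?addr0; last first.
    by move=> i /andP[/andP[si _] _]; rewrite nth_default//= mulr0.
  by rewrite -(big_nth z xpredT (fun d => 2 * d.2)) D_sum.
move=> x /(covered_or_avail s)[[d ds xd]|[d]]; last by rewrite s0.
by exists (index d s) => //; rewrite nth_index.
Qed.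

Let infinite_case : (forall s, valid s -> avail s !=set0) ->
  (hausdorff1_delta (14 * rho) A <= M%:E)%E.
Proof.
move=> vA.
have /choice[pick pickP] : forall s, exists d, valid s ->
    avail s d /\ forall e, avail s e -> e.2 <= 2 * d.2.
  move=> s; have [vs|nvs] := pselect (valid s); last by exists (0, 0).
  by have [d dP] := greedy_choice (vA s vs); exists d.
pose S := fix S k := if k is k'.+1 then pick (S k') :: S k' else [::].
pose d k := pick (S k).
have vS k : valid (S k).
  by elim: k => [|k IHk] //=; apply: valid_cons => //; exact: (pickP _ IHk).1.
have dA k : avail (S k) (d k) by exact: (pickP _ (vS k)).1.
have dmax k e : avail (S k) e -> e.2 <= 2 * (d k).2 by exact: (pickP _ (vS k)).2.
have d0 k : 0 < (d k).2 <= rho by apply: D_gt0; exact: (dA k).1.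
have Smem k e : e \in S k -> exists2 i, (i < k)%N & e = d i.
  elim: k => [//|k IHk]; rewrite /= in_cons => /predU1P[->|/IHk[i ik ->]].
    by exists k.
  by exists i => //; exact: ltnW.
pose T k := \sum_(0 <= i < k) 2 * (d i).2.
have TS k : T k = \sum_(e <- S k) 2 * e.2.
  elim: k => [|k IHk]; first by rewrite /T /= big_nil big_geq.
  by rewrite /T big_nat_recr//= big_cons addrC -IHk.
have TM k : T k <= M by rewrite TS; case: (vS k) => ? ?; exact: D_sum.
have T2 k K : (k <= K)%N -> T K - T k = \sum_(k <= i < K) 2 * (d i).2.
  by move=> kK; rewrite /T (big_cat_nat (n := k))//= addrAC subrr add0r.
apply/lee_addgt0Pr => eps eps0; rewrite -EFinD.
have [N TN] : exists N, forall K, T K - T N <= eps / 7.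
  have supT : has_sup (range T).
    by split; [exists (T 0%N), 0%N|exists M => _ [k _ <-]].
  have [_ [N _ <-] TN] := sup_adherent (divr_gt0 eps0 (@ltr0Sn _ 6)) supT.
  exists N => K; have : T K <= sup (range T).
    by apply: ub_le_sup; [case: supT|exists K].
  by move: TN; lra.
pose c i := if (i < N)%N then (d i).2 else 7 * (d i).2.
have c0 i : 0 <= c i.
  by rewrite /c; have /andP[/ltW + _] := d0 i; case: ifP => _; lra.
apply: (@hausdorff1_delta_le_discs _ _ (fun i => (d i).1) c _ N) => //.
- by rewrite mulr_ge0// ltW.
- by move=> i; rewrite /c; have /andP[] := d0 i; case: ifP => _; lra.
- move=> K NK; rewrite (big_cat_nat (n := N))//=.
  rewrite (_ : \sum_(0 <= i < N) _ = T N); last first.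
    by apply: eq_big_nat => i /= iN; rewrite /c iN.
  rewrite (_ : \sum_(N <= i < K) _ = 7 * (T K - T N)); last first.
    rewrite T2// mulr_sumr; apply: eq_big_nat => i /andP[Ni _].
    by rewrite /c ltnNge Ni/=; lra.
  by have := TN K; have := TM N; lra.
move=> x /(covered_or_avail (S N))[[e /Smem[i iN ->] xe]|[e eN xe]].
  by exists i => //; rewrite /c iN.
(* Otherwise e stays available, and by the greedy choice all radii after N are
   at least e.2 / 2. *)
have [j Nj [ej /negP edj]] :
    exists2 j, (N <= j)%N & avail (S j) e /\ ~ far_apart e (d j).
  apply: contrapT => H.
  have eS k : avail (S (N + k)%N) e.
    elim: k => [|k IHk]; first by rewrite addn0.
    rewrite addnS; split; first exact: IHk.1.
    rewrite /=; apply/andP; split; last exact: IHk.2.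
    apply: contrapT => /negP nfar; apply: H; exists (N + k)%N; first exact: leq_addr.
    by split=> //; exact/negP.
  have /andP[e0 _] := D_gt0 eN.1.
  have := archi_boundP (divr_ge0 (ltW eps0) (ltW e0)).
  set k := Num.bound _; rewrite ltr_pdivrMr//.
  have : k%:R * e.2 <= T (N + k)%N - T N.
    rewrite T2 ?leq_addr// mulr_natl -{1}[k](addKn N) -sumr_const_nat.
    rewrite big_nat [leRHS]big_nat; apply: ler_sum => i /andP[Ni _].
    by apply: dmax; rewrite -(subnKC Ni); exact: eS.
  by have := TN (N + k)%N; lra.
exists j => //; rewrite /disc /= /c ltnNge Nj /=.
have := enorm_triangle e.1 x (d j).1.
by move: edj (dmax j e ej) xe; rewrite /far_apart; lra.
Qed.

Lemma greedy_bound : (hausdorff1_delta (14 * rho) A <= M%:E)%E.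
Proof.
have [[s [vs s0]]|H] := pselect (exists s, valid s /\ avail s = set0).
  exact: stuck_case s0.
apply: infinite_case => s vs; apply/set0P/negP => /eqP s0.
by apply: H; exists s.
Qed.

End Greedy.

(** Discs far apart from each other bound the measure of A as soon as D contains
    arbitrarily small discs at a distance from each point of A comparable with
    their radius. *)
Lemma vitali_hausdorff1 D A (M : R) :
  (forall s, (forall d, d \in s -> D d) -> pairwise far_apart s ->
    \sum_(d <- s) 2 * d.2 <= M) ->
  (forall x (e : R), A x -> 0 < e -> exists d,
    [/\ D d, 0 < d.2, enorm (x - d.1) + d.2 <= e & enorm (x - d.1) <= 2 * d.2]) ->
  (hausdorff1 A <= M%:E)%E.
Proof.
move=> Dsum Dfine; apply: ge_ereal_sup => _ [delta /= delta0 <-].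
have rho0 : 0 < delta / 14 by rewrite divr_gt0.
rewrite (_ : delta = 14 * (delta / 14)); last by rewrite mulrC divfK.
apply: (@greedy_bound (D `&` [set d | 0 < d.2 <= delta / 14])) => //.
- by move=> d [].
- by move=> s sD; apply: Dsum => d /sD[].
move=> x e Ax e0.
have [|d [Dd d0 xd dx]] := Dfine x (Num.min e (delta / 14)) Ax.
  by rewrite lt_min e0.
exists d; split=> //; last by rewrite (le_trans xd)// ge_min lexx.
split=> //=; rewrite d0 /=.
rewrite (@le_trans _ _ (enorm (x - d.1) + d.2)) ?lerDr ?enorm_ge0//.
by rewrite (le_trans xd)// ge_min lexx orbT.
Qed.

End VitaliCovering.
(** * Chains in connected sets *)

Section Chains.
Context {R : realType} {n : nat}.
Local Notation V := 'rV[R]_n.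
Implicit Types (C : set V) (x b p : V) (eta r : R).

Lemma enorm_dist_lipschitz p x y : `|enorm (x - p) - enorm (y - p)| <= enorm (x - y).
Proof.
have := enorm_triangle y x p; have := enorm_triangle x y p.
by rewrite (enorm_distC y x) ler_norml => *; apply/andP; split; lra.
Qed.

Lemma connected_dist_values C p q (t : R) : connected C -> C p -> C q ->
  0 <= t <= enorm (q - p) -> exists2 z, C z & enorm (z - p) = t.
Proof.
move=> cC Cp Cq tpq.
have cu : continuous (fun z : V => enorm (z - p)).
  move=> z; apply/(@cvgrPdist_lt _ _ _ (nbhs z) (nbhs_filter z)) => e e0; have := near_enorm z e0.
  apply: filterS => w wz; rewrite distrC; apply: le_lt_trans wz.
  exact: enorm_dist_lipschitz.
have /connected_intervalP itv :=
  connected_continuous_connected cC (continuous_subspaceT cu).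
have [||z Cz zt] := itv 0 (enorm (q - p)) _ _ t tpq; last by exists z.
- by exists p => //; rewrite subrr enorm0.
- by exists q.
Qed.

(** The distance to p takes all values between 0 and r on C. *)
Lemma connected_hausdorff1_disc C p q r : connected C -> C p -> C q ->
  r <= enorm (q - p) -> (r%:E <= hausdorff1 (C `&` disc p r))%E.
Proof.
move=> cC Cp Cq rpq; rewrite -[r]subr0.
apply: (@hausdorff1_ge_projection _ _ _ (fun z => enorm (z - p)) 0 r).
  exact: enorm_dist_lipschitz.
move=> t; rewrite /= in_itv /= subr0 => /andP[t0 tr].
have [|z Cz zt] := connected_dist_values (t := t) cC Cp Cq.
  by rewrite t0 (le_trans tr).
by exists z => //; split => //; rewrite /disc /= zt.
Qed.

Definition chain C eta (N : nat) (y : nat -> V) :=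
  (forall k, (k <= N)%N -> C (y k)) /\
  (forall k, (k < N)%N -> enorm (y k - y k.+1) <= eta).

Let open_thickening (E : set V) eta :
  open [set z | exists2 w, E w & enorm (z - w) < eta].
Proof.
rewrite openE => z [w Ew zw]; rewrite /interior.
have e0 : 0 < eta - enorm (z - w) by rewrite subr_gt0.
have := near_enorm z e0; apply: filterS => z' z'z; exists w => //.
by have := enorm_triangle z z' w; lra.
Qed.

(** The points of C that can be reached from x by chains form a subset of C that
    is relatively open and relatively closed. *)
Lemma connected_chain C eta x b : 0 < eta -> connected C -> C x -> C b ->
  exists N y, [/\ chain C eta N y, y 0%N = x & y N = b].
Proof.
move=> eta0 cC Cx Cb.
pose B := [set z | exists N y, [/\ chain C eta N y, y 0%N = x & y N = z]].
have BC : B `<=` C by move=> z [N [y [[yC _] _ <-]]]; exact: yC.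
have Bstep w z : B w -> C z -> enorm (z - w) < eta -> B z.
  move=> [N [y [[yC yeta] y0 yN]]] Cz zw.
  exists N.+1, (fun k => if (k <= N)%N then y k else z).
  split; [split=> k; case: ifP => kN|by []|by rewrite ltnn] => //.
  - by move=> _; exact: yC.
  - rewrite ltnS => kN'; case: ifPn => [|NkN]; first exact: yeta.
    rewrite (_ : k = N) ?yN; last by apply/eqP; rewrite eqn_leq kN leqNgt.
    by rewrite enorm_distC ltW.
  - by rewrite ltnS kN.
suff BCE : B = C by suff : B b by []; rewrite BCE.
apply: cC.
- by exists x, 0%N, (fun=> x); split.
- exists [set z | exists2 w, B w & enorm (z - w) < eta]; first exact: open_thickening.
  apply/seteqP; split=> [z Bz|z [Cz [w Bw]]]; last exact: Bstep.
  by split; [exact: BC|exists z => //; rewrite subrr enorm0].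
- exists (~` [set z | exists2 w, (C `\` B) w & enorm (z - w) < eta]).
    exact/open_closedC/open_thickening.
  apply/seteqP; split=> [z Bz|z [Cz nz]].
    split; first exact: BC.
    move=> [w [Cw nBw] zw]; apply: nBw; apply: Bstep Bz Cw _.
    by rewrite enorm_distC.
  apply: contrapT => nBz; apply: nz; exists z => //.
  by rewrite subrr enorm0.
Qed.

(** In a chain with the least number of steps, two non-consecutive points at
    distance at most eta would provide a shortcut. *)
Lemma shortest_chain C eta x b r : 0 < eta -> 0 < r -> connected C -> C x -> C b ->
  r <= enorm (b - x) ->
  exists N y, [/\ (0 < N)%N, chain C eta N y, y 0%N = x, r <= enorm (y N - x) &
    (forall k, (k < N)%N -> enorm (y k - x) < r) /\
    (forall i j, (i.+1 < j)%N -> (j <= N)%N -> eta < enorm (y i - y j))].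
Proof.
move=> eta0 r0 cC Cx Cb rb.
pose exits N y := [/\ chain C eta N y, y 0%N = x & r <= enorm (y N - x)].
have exP : exists N, `[< exists y, exits N y >].
  have [N [y [yC y0 yN]]] := connected_chain eta0 cC Cx Cb.
  by exists N; apply/asboolP; exists y; split=> //; rewrite yN.
case: (ex_minnP exP) => N /asboolP[y [[yC yeta] y0 yN]] Nmin.
have {}Nmin N' y' : exits N' y' -> (N <= N')%N.
  by move=> e; apply: Nmin; apply/asboolP; exists y'.
exists N, y; split=> //.
  by rewrite lt0n; apply/eqP => N0; move: yN; rewrite N0 y0 subrr enorm0 leNgt r0.
split=> [k kN|i j ij jN]; rewrite ltNge; apply/negP => H.
  have : exits k y.
    split=> //; split=> l lk; [apply: yC|apply: yeta]; apply: leq_trans lk _;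
      exact: ltnW.
  by move=> /Nmin; rewrite leqNgt kN.
pose m := (j - i.+1)%N.
(* y' jumps from y i directly to y j. *)
pose y' k := if (k <= i)%N then y k else y (k + m)%N.
have : exits (N - m)%N y'.
  split; [split=> k kN|by rewrite /y'|].
  - by rewrite /y'; case: ifP => ki; apply: yC; rewrite /m in kN *; lia.
  - rewrite /y'; case: ifPn => ki; last first.
      by rewrite ifN ?addSn; [apply: yeta; rewrite /m in kN *; lia|lia].
    case: ifPn => ki'; first by apply: yeta; rewrite /m in kN *; lia.
    have -> : k = i by lia.
    by rewrite (_ : (i.+1 + m)%N = j)// /m; lia.
  - rewrite /y' ifN; last by rewrite /m; lia.
    by rewrite subnK// /m; lia.
by move=> /Nmin; rewrite /m; lia.
Qed.

(** Every other point of a shortest chain is the centre of a disc of radius eta / 2;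
    these discs are far apart, and C crosses each of them, so that it has length
    at least eta / 2 in it.  This bounds the number of steps, hence the Lipschitz
    constant of the chain seen as a curve with jumps of size eta. *)
Lemma shortest_chain_length C eta x b r r' (M : R) : 0 < eta -> eta <= r ->
  connected C -> C x -> C b -> r <= enorm (b - x) -> r + eta * 2 <= r' ->
  (hausdorff1 (C `&` disc x r') <= M%:E)%E ->
  exists N y, [/\ (0 < N)%N, chain C eta N y, y 0%N = x, r <= enorm (y N - x) &
    (forall k, (k <= N)%N -> enorm (y k - x) <= r + eta) /\ N%:R * eta <= 4 * M].
Proof.
move=> eta0 etar cC Cx Cb rb rr' HM.
have r0 : 0 < r := lt_le_trans eta0 etar.
have [N [y [N0 [yC yeta] y0 yN [yr far]]]] := shortest_chain eta0 r0 cC Cx Cb rb.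
have yr' k : (k <= N)%N -> enorm (y k - x) <= r + eta.
  rewrite leq_eqVlt => /predU1P[->|/yr]; last by lra.
  have := yeta N.-1; have := yr N.-1; rewrite prednK// leqnn => /(_ isT) + /(_ isT).
  by have := enorm_triangle (y N.-1) (y N) x; rewrite (enorm_distC (y N) (y _)); lra.
exists N, y; split=> //; split=> //.
pose s := [seq (y k.*2, eta / 2) | k <- iota 0 N./2.+1].
have s_sep : pairwise far_apart s.
  rewrite pairwise_map; apply: (@sub_in_pairwise _ (mem (iota 0 N./2.+1)) ltn).
  - move=> i j _; rewrite inE mem_iota => jN ij.
    rewrite /far_apart /= -splitr; apply: far; lia.
  - by apply/allP => i.
  - by rewrite -(sorted_pairwise ltn_trans) iota_ltn_sorted.
have /le_trans/(_ HM) := sum_hausdorff1_discs (C `&` disc x r') s_sep.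
rewrite big_map.
have : (\sum_(k <- iota 0 N./2.+1) (eta / 2)%:E <= \sum_(k <- iota 0 N./2.+1)
    hausdorff1 (C `&` disc x r' `&` disc (y k.*2) (eta / 2)))%E.
  rewrite big_seq [leRHS]big_seq; apply: lee_sum => k.
  rewrite mem_iota => kN; have k2N : (k.*2 <= N)%N by lia.
  apply: (@le_trans _ _ (hausdorff1 (C `&` disc (y k.*2) (eta / 2)))); last first.
    apply: le_hausdorff1 => z [Cz zy]; split=> //; split=> //.
    rewrite /disc /= in zy *; have := enorm_triangle (y k.*2) z x.
    by have := yr' _ k2N; lra.
  have := enorm_triangle (y k.*2) b x => byx.
  have [yb|yb] := leP (eta / 2) (enorm (b - y k.*2)).
    exact: connected_hausdorff1_disc (yC _ k2N) Cb yb.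
  apply: connected_hausdorff1_disc (yC _ k2N) Cx _ => //.
  by rewrite (enorm_distC x); lra.
move=> /le_trans h /h; rewrite sumEFin lee_fin big_const_seq count_predT size_iota.
rewrite iter_addr_0 -mulr_natl => {h} h.
have : N%:R <= (N./2.+1)%:R * 2 :> R by rewrite -natrM ler_nat; lia.
move=> /(ler_wpM2r (ltW eta0)); lra.
Qed.

End Chains.
(** * Lipschitz curves in connected sets of finite length *)

Section Curves.
Context {R : realType} {n : nat}.
Local Notation V := 'rV[R]_n.
Implicit Types (C : set V) (x b p : V) (eta r L : R) (f g : R -> V).

(** For eta = 0 this is an L-Lipschitz curve in C, inside the closed disc of
    centre x and radius r, that runs from x to the boundary of the disc.  A
    positive eta allows jumps, so that chains are included, while the relation
    stays closed under pointwise limits. *)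
Definition almost_curve C x r L eta f :=
  [/\ f 0 = x, r <= enorm (f 1 - x),
    forall t, 0 <= t <= 1 -> C (f t),
    forall t, 0 <= t <= 1 -> enorm (f t - x) <= r + eta &
    forall s t, 0 <= s -> s <= t -> t <= 1 -> enorm (f s - f t) <= L * (t - s) + eta].

Lemma almost_curveW C x r L L' eta eta' f : L <= L' -> eta <= eta' ->
  almost_curve C x r L eta f -> almost_curve C x r L' eta' f.
Proof.
move=> LL ee [f0 f1 fC fx fL]; split=> // [t t01|s t s0 st t1].
  by rewrite (le_trans (fx _ t01))// lerD2l.
rewrite (le_trans (fL s t s0 st t1))// lerD// ler_wpM2r// subr_ge0//.
Qed.

Lemma almost_curve_of_chain C x r eta L N (y : nat -> V) : (0 < N)%N -> 0 <= eta ->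
  chain C eta N y -> y 0%N = x -> r <= enorm (y N - x) ->
  (forall k, (k <= N)%N -> enorm (y k - x) <= r + eta) -> N%:R * eta <= L ->
  almost_curve C x r L eta (fun t : R => y (Num.truncn (N%:R * t))).
Proof.
move=> N0 eta0 [yC yeta] y0 yN yr NL.
have tN (t : R) : 0 <= t <= 1 -> (Num.truncn (N%:R * t) <= N)%N.
  move=> /andP[t0 t1]; have /le_truncn : N%:R * t <= N%:R :> R by rewrite ler_piMr.
  by rewrite natrK.
have step k l : (k <= l)%N -> (l <= N)%N -> enorm (y k - y l) <= (l%:R - k%:R) * eta.
  elim: l => [|l IHl]; first by rewrite leqn0 => /eqP->; rewrite !subrr enorm0 mul0r.
  rewrite leq_eqVlt => /predU1P[-> _|kl lN]; first by rewrite !subrr enorm0 mul0r.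
  have := IHl kl (ltnW lN); have := yeta l lN; have := enorm_triangle (y l) (y k) (y l.+1).
  by rewrite -natr1; lra.
split=> [|||t t01|s t s0 st t1].
- by rewrite mulr0 truncn0.
- by rewrite mulr1 natrK.
- by move=> t t01; exact/yC/tN.
- exact/yr/tN.
have Ns0 : 0 <= N%:R * s by rewrite mulr_ge0.
have Nst : N%:R * s <= N%:R * t by rewrite ler_wpM2l.
have /andP[ks sk] := truncn_itv Ns0.
have /andP[lt tl] := truncn_itv (le_trans Ns0 Nst).
have t01 : 0 <= t <= 1 by rewrite t1 (le_trans s0).
apply: le_trans (step _ _ (le_truncn Nst) (tN _ t01)) _.
rewrite -natr1 in sk.
have h : (Num.truncn (N%:R * t))%:R - (Num.truncn (N%:R * s))%:R <= N%:R * (t - s) + 1.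
  by rewrite mulrBr; lra.
rewrite (le_trans (ler_wpM2r eta0 h))// mulrDl mul1r lerD2r mulrAC.
by rewrite ler_wpM2r// subr_ge0.
Qed.

Lemma enorm_ultra_le (T : Type) (W : set_system T) {UW : UltraFilter W}
    (f g : T -> V) p q (c : R) :
  (forall e, 0 < e -> \forall k \near W, enorm (f k - p) < e) ->
  (forall e, 0 < e -> \forall k \near W, enorm (g k - q) < e) ->
  (forall e, 0 < e -> \forall k \near W, enorm (f k - g k) <= c + e) ->
  enorm (p - q) <= c.
Proof.
move=> fp gq fg; apply/ler_addgt0Pr => e e0.
have e3 : 0 < e / 3 by rewrite divr_gt0.
have : \forall k \near W, enorm (p - q) <= c + e.
  near=> k.
  have : enorm (f k - p) < e / 3 by near: k; exact: fp.
  have : enorm (g k - q) < e / 3 by near: k; exact: gq.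
  have : enorm (f k - g k) <= c + e / 3 by near: k; exact: fg.
  have := enorm_triangle (f k) p q; have := enorm_triangle (g k) (f k) q.
  by rewrite (enorm_distC p (f k)); lra.
by move=> /filter_ex[].
Unshelve. all: by end_near. Qed.

(** The limit along an ultrafilter of almost curves with eta = 1/(k+1) is taken
    point by point.  With a constant L it turns chains into a curve; with L + eta
    it shows that the infimum of the Lipschitz constants is attained. *)
Lemma almost_curve_limit C x r L : closed C ->
  (forall eta, 0 < eta -> exists f, almost_curve C x r (L + eta) eta f) ->
  exists f, almost_curve C x r L 0 f.
Proof.
move=> clC Hf.
have [W [UW ooW]] := ultraFilterLemma eventually_filter.
pose eta k : R := k.+1%:R^-1.
have /choice[F FP] : forall k, exists f, almost_curve C x r (L + eta k) (eta k) f.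
  by move=> k; apply: Hf; rewrite invr_gt0.
have eta1 k : eta k <= 1 by rewrite invf_le1// ler1n.
have eta_small e : 0 < e -> \forall k \near W, eta k < e.
  move=> e0; apply: ooW; near=> k; rewrite /eta.
  by near: k; exact: near_infty_natSinv_lt (PosNum e0).
have /choice[f fP] : forall t, exists p, 0 <= t <= 1 ->
    forall e, 0 < e -> \forall k \near W, enorm (F k t - p) < e.
  move=> t; have [t01|nt] := pselect (0 <= t <= 1); last by exists 0.
  have [|p pP] := @ultra_limit_enorm _ W _ R n (F^~ t) x (r + 1); last by exists p.
  apply: nearW => k; have [_ _ _ /(_ _ t01) h _] := FP k.
  by rewrite (le_trans h)// lerD2l.
have cst p e : 0 < e -> \forall k \near W, enorm (p - p : V) < e.
  by move=> e0; apply: nearW => k; rewrite subrr enorm0.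
have i0 : 0 <= (0 : R) <= 1 by rewrite lexx ler01.
have i1 : 0 <= (1 : R) <= 1 by rewrite ler01 lexx.
exists f; split.
- apply/eqP; rewrite -subr_eq0; apply/eqP/enorm_eq0/eqP.
  rewrite eq_le enorm_ge0 andbT.
  apply: (enorm_ultra_le (fP 0 i0) (cst x)) => e e0; apply: nearW => k.
  by have [-> _ _ _ _] := FP k; rewrite subrr enorm0 add0r ltW.
- apply/ler_addgt0Pr => e e0.
  have : \forall k \near W, enorm (F k 1 - f 1) < e by exact: fP.
  move=> /filter_ex[k]; have [_ + _ _ _] := FP k.
  by have := enorm_triangle (f 1) (F k 1) x; lra.
- move=> t t01; apply: closed_enorm => // e e0.
  have /filter_ex[k kP] := fP t t01 e e0; exists (F k t) => //.
  by have [_ _ + _ _] := FP k; exact.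
- move=> t t01; rewrite addr0.
  apply: (enorm_ultra_le (fP t t01) (cst x)) => e /eta_small; apply: filterS => k ke.
  have [_ _ _ /(_ _ t01) + _] := FP k.
  by move=> /le_trans; apply; rewrite lerD2l ltW.
move=> s t s0 st t1; rewrite addr0.
have s01 : 0 <= s <= 1 by rewrite s0 (le_trans st).
have t01 : 0 <= t <= 1 by rewrite t1 (le_trans s0).
apply: (enorm_ultra_le (fP s s01) (fP t t01)) => e e0.
have : \forall k \near W, eta k < e / 2 by apply: eta_small; rewrite divr_gt0.
apply: filterS => k ke; have [_ _ _ _ /(_ s t s0 st t1)] := FP k.
move=> /le_trans; apply; rewrite mulrDl -addrA lerD2l.
have : eta k * (t - s) <= eta k by rewrite ler_piMr ?invr_ge0//; lra.
lra.
Unshelve. all: by end_near. Qed.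

Lemma shortest_curve C x r : 0 <= r -> closed C ->
  (exists L f, almost_curve C x r L 0 f) ->
  exists L f, almost_curve C x r L 0 f /\
    forall L' g, almost_curve C x r L' 0 g -> L <= L'.
Proof.
move=> r0 clC [L0 [f0 f0P]].
pose E := [set L | exists f, almost_curve C x r L 0 f].
have infE : has_inf E.
  split; first by exists L0, f0.
  exists 0 => L [f [fx fr _ _ /(_ 0 1 (lexx _) ler01 (lexx _))]].
  by rewrite subr0 addr0 mulr1 fx; apply: le_trans; exact: enorm_ge0.
have [|f fP] := @almost_curve_limit C x r (inf E) clC.
  move=> eta eta0; have [L [f fP] Le] := inf_adherent eta0 infE.
  by exists f; apply: almost_curveW fP; exact: ltW.
exists (inf E), f; split=> // L g gP; apply: ge_inf; first by case: infE.
by exists g.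
Qed.

(** If f s = f t with s < t, skipping [s, t] and stretching the rest of the
    parameter interval to [0, 1] multiplies the Lipschitz constant by
    1 - (t - s) < 1. *)
Lemma shortest_curve_inj C x r L f : 0 < r -> almost_curve C x r L 0 f ->
  (forall L' g, almost_curve C x r L' 0 g -> L <= L') ->
  forall s t, 0 <= s -> s < t -> t <= 1 -> f s <> f t.
Proof.
move=> r0 [f0 fr fC fx fL] Lmin s t s0 st t1 fst.
have L0 : 0 < L.
  have := fL 0 1 (lexx _) ler01 (lexx _).
  rewrite subr0 mulr1 addr0 f0 enorm_distC; apply: lt_le_trans.
  exact: lt_le_trans fr.
pose k := 1 - (t - s).
(* At u = 1 the first branch can only be taken when t = 1, and then f s is the
   endpoint f t. *)
pose cut u := if u * k <= s then u * k else u * k + (t - s).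
have k0 : 0 <= k by rewrite /k; lra.
have uk u : 0 <= u <= 1 -> 0 <= u * k <= k.
  by move=> /andP[u0 u1]; rewrite mulr_ge0//= ler_piMl.
have cut01 u : 0 <= u <= 1 -> 0 <= cut u <= 1.
  by move=> /uk /andP[]; rewrite /cut; case: ifP => h; rewrite /k => *; lra.
suff : L <= L * k.
  by apply/negP; rewrite -ltNge gtr_pMr// /k; lra.
apply: (Lmin _ (f \o cut)); split=> /=.
- by rewrite /cut mul0r s0.
- rewrite /cut mul1r; case: ifPn => [ks|_]; last by rewrite /k subrK.
  have -> : k = s by apply/eqP; rewrite eq_le ks /k; lra.
  by rewrite fst (_ : t = 1)//; move: ks; rewrite /k; lra.
- by move=> u /cut01; exact: fC.
- by move=> u /cut01; exact: fx.
move=> u v u0 uv v1.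
have u01 : 0 <= u <= 1 by rewrite u0 (le_trans uv).
have v01 : 0 <= v <= 1 by rewrite v1 (le_trans u0).
have uvk : u * k <= v * k by rewrite ler_wpM2r.
have /andP[uk0 uk1] := uk _ u01; have /andP[vk0 vk1] := uk _ v01.
have /andP[cu0 cu1] := cut01 _ u01; have /andP[cv0 cv1] := cut01 _ v01.
have -> : L * k * (v - u) = L * (v * k - u * k) by ring.
move: cu0 cu1 cv0 cv1; rewrite /cut; case: ifPn => us; case: ifPn => vs *.
- exact: fL.
- rewrite (le_trans (enorm_triangle (f s) _ _))// {2}fst.
  have := fL (u * k) s uk0 us (ltW (lt_le_trans st t1)).
  have := fL t (v * k + (t - s)); rewrite !addr0 => h1 h2.
  have : enorm (f t - f (v * k + (t - s))) <= L * (v * k + (t - s) - t).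
    by apply: h1; lra.
  lra.
- lra.
have := fL (u * k + (t - s)) (v * k + (t - s)).
by rewrite (_ : v * k + _ - _ = v * k - u * k); [apply; lra|lra].
Qed.

Lemma lipschitz_on_IVT (g : R -> R) (a b v L : R) : a <= b ->
  (forall s t, a <= s -> s <= t -> t <= b -> `|g s - g t| <= L * (t - s)) ->
  Num.min (g a) (g b) <= v <= Num.max (g a) (g b) ->
  exists2 c, a <= c <= b & g c = v.
Proof.
move=> ab gL vab.
have [|c] := IVT (f := g) ab _ vab; last by rewrite in_itv; exists c.
apply/subspace_continuousP => s /=; rewrite in_itv /= => /andP[as_ sb].
apply/cvgrPdist_lt => e e0.
have L1 : 0 < `|L| + 1 by rewrite ltr_wpDl.
have := nbhsx_ballx s (e / (`|L| + 1)) (divr_gt0 e0 L1).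
apply: filterS => t; rewrite -ball_normE /= => st; rewrite in_itv /= => /andP[at_ tb].
have key : `|g s - g t| <= L * `|s - t|.
  have [le_st|/ltW le_ts] := leP s t.
    by rewrite distrC (distrC s) [`|t - s|]ger0_norm ?subr_ge0// distrC gL.
  by rewrite distrC [`|s - t|]ger0_norm ?subr_ge0// gL.
rewrite (le_lt_trans key)// (@le_lt_trans _ _ ((`|L| + 1) * `|s - t|))//.
  by rewrite ler_wpM2r// (le_trans (ler_norm _))// lerDl.
by rewrite mulrC -ltr_pdivlMr.
Qed.

End Curves.
(** * Concentration of length in discs *)

Section Concentration.
Context {R : realType} {n : nat}.
Local Notation V := 'rV[R]_n.
Implicit Types (C : set V) (x b p : V) (r L : R) (f : R -> V).

Lemma exists_lipschitz_curve C x b r r' : closed C -> connected C -> C x -> C b ->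
  0 < r -> r <= enorm (b - x) -> r < r' ->
  (hausdorff1 (C `&` disc x r') < +oo)%E ->
  exists L f, almost_curve C x r L 0 f.
Proof.
move=> clC cC Cx Cb r0 rb rr' Hfin.
pose M := fine (hausdorff1 (C `&` disc x r')).
have HM : (hausdorff1 (C `&` disc x r') <= M%:E)%E.
  by rewrite /M fineK// ge0_fin_numE// hausdorff1_ge0.
exists (4 * M); apply: almost_curve_limit => // eta eta0.
pose e := Num.min eta (Num.min r ((r' - r) / 2)).
have e0 : 0 < e by rewrite /e !lt_min eta0 r0 divr_gt0// subr_gt0.
have eeta : e <= eta by rewrite /e ge_min lexx.
have er : e <= r by rewrite /e !ge_min lexx orbT.
have er' : e <= (r' - r) / 2 by rewrite /e !ge_min lexx !orbT.
have [|N [y [N0 yC y0 yN [yr Ne]]]] :=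
  shortest_chain_length e0 er cC Cx Cb rb _ HM; first by lra.
exists (fun t : R => y (Num.truncn (N%:R * t))).
apply: (@almost_curveW _ _ _ _ _ (4 * M) _ e) => //; first by lra.
exact: almost_curve_of_chain (ltW e0) yC y0 yN yr Ne.
Qed.

(** By compactness a vanishing distance between the two arcs would be attained at
    f s = f t with s <= c <= t; the first point is not p, hence s < t, against
    injectivity. *)
Lemma separated_arcs L f p rho (c : R) : 0 <= c <= 1 -> 0 < rho ->
  (forall s t, 0 <= s -> s <= t -> t <= 1 -> enorm (f s - f t) <= L * (t - s)) ->
  (forall s t, 0 <= s -> s < t -> t <= 1 -> f s <> f t) -> f c = p ->
  exists2 sigma, 0 < sigma & forall s t, 0 <= s <= c -> c <= t <= 1 ->
    rho <= enorm (f s - p) -> sigma <= enorm (f s - f t).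
Proof.
move=> /andP[c0 c1] rho0 fL finj fc; apply: contrapT => nsep.
have /choice[st stP] : forall k, exists st : R * R, [/\ 0 <= st.1 <= c, c <= st.2 <= 1,
    rho <= enorm (f st.1 - p) & enorm (f st.1 - f st.2) < k.+1%:R^-1].
  move=> k; apply: contrapT => nst; apply: nsep.
  exists k.+1%:R^-1; first by rewrite invr_gt0.
  move=> s t sc tc sp; rewrite leNgt; apply/negP => fst; apply: nst.
  by exists (s, t).
have [W [UW ooW]] := ultraFilterLemma eventually_filter.
have [|s /andP[s0 sc] sl] := @ultra_limit_real _ W _ _ (fun k => (st k).1) 0 c.
  by apply: nearW => k; case: (stP k).
have [|t /andP[tc t1] tl] := @ultra_limit_real _ W _ _ (fun k => (st k).2) c 1.
  by apply: nearW => k; case: (stP k).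
have L0 : 0 < `|L| + 1 by rewrite ltr_wpDl.
have fL' u v : 0 <= u <= 1 -> 0 <= v <= 1 ->
    enorm (f u - f v) <= (`|L| + 1) * `|u - v|.
  move=> /andP[u0 u1] /andP[v0 v1].
  have LL : L <= `|L| + 1 by rewrite (le_trans (ler_norm _))// lerDl.
  have [uv|/ltW vu] := leP u v.
    rewrite distrC [`|v - u|]ger0_norm ?subr_ge0// (le_trans (fL _ _ u0 uv v1))//.
    by rewrite ler_wpM2r// subr_ge0.
  rewrite enorm_distC [`|u - v|]ger0_norm ?subr_ge0// (le_trans (fL _ _ v0 vu u1))//.
  by rewrite ler_wpM2r// subr_ge0.
have flim (u : nat -> R) v : (forall k, 0 <= u k <= 1) -> 0 <= v <= 1 ->
    (forall e, 0 < e -> \forall k \near W, `|u k - v| < e) ->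
    forall e, 0 < e -> \forall k \near W, enorm (f (u k) - f v) < e.
  move=> u01 v01 uv e e0; have := uv _ (divr_gt0 e0 L0); apply: filterS => k.
  rewrite ltr_pdivlMr// mulrC => h.
  exact: le_lt_trans (fL' _ _ (u01 k) v01) h.
have fsl := flim (fun k => (st k).1) s _ _ sl.
have ftl := flim (fun k => (st k).2) t _ _ tl.
have fst : f s = f t.
  apply/eqP; rewrite -subr_eq0; apply/eqP/enorm_eq0/eqP.
  rewrite eq_le enorm_ge0 andbT.
  apply: (@enorm_ultra_le _ _ _ W _ _ _ _ _ _ (fsl _ _) (ftl _ _)).
  - move=> k; have [/andP[? ?] _ _ _] := stP k; apply/andP; split=> //; lra.
  - by rewrite s0 (le_trans sc).
  - move=> k; have [_ /andP[? ?] _ _] := stP k; apply/andP; split=> //; lra.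
  - by rewrite t1 (le_trans c0).
  move=> e e0; apply: ooW; near=> k; rewrite add0r ltW//.
  have [_ _ _ h] := stP k; apply: (lt_trans h).
  by near: k; exact: near_infty_natSinv_lt (PosNum e0).
have sp : rho <= enorm (f s - p).
  apply/ler_addgt0Pr => e e0.
  have /filter_ex[k] : \forall k \near W, enorm (f (st k).1 - f s) < e.
    apply: fsl => //; last by rewrite s0 (le_trans sc).
    by move=> k; have [/andP[? ?] _ _ _] := stP k; apply/andP; split=> //; lra.
  have [_ _ h _] := stP k; have := enorm_triangle (f s) (f (st k).1) p.
  by move: h; lra.
have st_lt : s < t.
  rewrite lt_neqAle (le_trans sc tc) andbT; apply/eqP => sE.
  have : s = c by apply/eqP; rewrite eq_le sc sE tc.
  by move: sp => /[swap] ->; rewrite fc subrr enorm0 leNgt rho0.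
exact: finj s0 st_lt t1 fst.
Unshelve. all: by end_near. Qed.

(** The disc is centred at a point p half way along the curve, in terms of the
    distance to x.  Each of the two arcs that leave p reaches distance r / 2 from
    it, so the part of each arc outside the disc of radius rho has length at
    least r / 2 - rho; these two parts are at a positive distance. *)
Lemma hausdorff1_disc_ge C x b r r' : closed C -> connected C -> C x -> C b ->
  0 < r -> r <= enorm (b - x) -> r < r' ->
  (hausdorff1 (C `&` disc x r') < +oo)%E ->
  exists p, enorm (p - x) = r / 2 /\ (r%:E <= hausdorff1 (C `&` disc p (r / 2)))%E.
Proof.
move=> clC cC Cx Cb r0 rb rr' Hfin.
have [L [f [fP Lmin]]] := shortest_curve (ltW r0) clC
  (exists_lipschitz_curve clC cC Cx Cb r0 rb rr' Hfin).
have finj := shortest_curve_inj r0 fP Lmin.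
case: fP => f0 fr fC _ fL0.
have fL s t : 0 <= s -> s <= t -> t <= 1 -> enorm (f s - f t) <= L * (t - s).
  by move=> s0 st t1; rewrite -[leRHS]addr0 fL0.
have value q a c v : 0 <= a -> a <= c -> c <= 1 ->
    Num.min (enorm (f a - q)) (enorm (f c - q)) <= v <=
    Num.max (enorm (f a - q)) (enorm (f c - q)) ->
    exists2 t, a <= t <= c & enorm (f t - q) = v.
  move=> a0 ac c1; apply: (lipschitz_on_IVT (g := fun t => enorm (f t - q)) (L := L)) => //
    s t as_ st tc.
  rewrite (le_trans (enorm_dist_lipschitz _ _ _))// fL//; lra.
have [c /andP[c0 c1] cr] : exists2 c, 0 <= c <= 1 & enorm (f c - x) = r / 2.
  apply: value => //; rewrite f0 subrr enorm0 ge_min le_max.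
  by apply/andP; split; apply/orP; [left|right]; lra.
exists (f c); split=> //; set p := f c.
have f0p : enorm (f 0 - p) = r / 2 by rewrite f0 enorm_distC.
have f1p : r / 2 <= enorm (f 1 - p).
  by have := enorm_triangle p (f 1) x; rewrite /p cr; lra.
have fcp : enorm (f c - p) = 0 by rewrite subrr enorm0.
pose arc rho a d := [set z | exists2 t, a <= t <= d &
  z = f t /\ rho <= enorm (f t - p) <= r / 2].
have arc_ge rho a d : 0 <= a -> a <= d -> d <= 1 -> 0 <= rho ->
    Num.min (enorm (f a - p)) (enorm (f d - p)) <= rho ->
    r / 2 <= Num.max (enorm (f a - p)) (enorm (f d - p)) ->
    ((r / 2 - rho)%:E <= hausdorff1 (arc rho a d))%E.
  move=> a0 ad d1 rho0 mn mx.
  apply: (@hausdorff1_ge_projection _ _ _ (fun z => enorm (z - p)) rho (r / 2)).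
    exact: enorm_dist_lipschitz.
  move=> v; rewrite /= in_itv /= => /andP[v1 v2].
  have [|t ta tv] := value p a d v a0 ad d1.
    by rewrite (le_trans mn)//= (le_trans v2).
  by exists (f t) => //; exists t => //; rewrite tv v1 v2.
have arc_sub rho a d : 0 <= a -> d <= 1 -> arc rho a d `<=` C `&` disc p (r / 2).
  move=> a0 d1 _ [t /andP[ta td] [-> /andP[_ tr]]]; split=> //.
  by apply: fC; rewrite (le_trans a0 ta) (le_trans td).
apply/lee_addgt0Pr => e e0.
pose rho := Num.min (e / 2) (r / 2).
have rho0 : 0 < rho by rewrite /rho lt_min !divr_gt0.
have rhoe : rho <= e / 2 by rewrite /rho ge_min lexx.
have [|sigma sigma0 sep] := @separated_arcs L f p rho c _ rho0 fL finj erefl.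
  by rewrite c0.
have : (hausdorff1 (arc rho 0%R c) + hausdorff1 (arc rho c 1%R) <=
    hausdorff1 (C `&` disc p (r / 2)))%E.
  apply: (@le_trans _ _ (hausdorff1 (arc rho 0%R c `|` arc rho c 1%R))); last first.
    by apply: le_hausdorff1; rewrite subUset; split; apply: arc_sub.
  apply: (hausdorff1_setU_far sigma0) => y z [s sc [-> /andP[sp _]]].
  by move=> [t tc [-> _]]; exact: sep.
rewrite -leeBlDr// -EFinB; apply: le_trans.
rewrite (_ : r - e = (r / 2 - e / 2) + (r / 2 - e / 2)); last by lra.
rewrite EFinD; apply: leeD.
  apply: (@le_trans _ _ (r / 2 - rho)%:E); first by rewrite lee_fin lerD2l lerN2.
  by apply: arc_ge; rewrite ?f0p ?fcp ?ge_min ?le_max ?lexx ?(ltW rho0) ?orbT.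
apply: (@le_trans _ _ (r / 2 - rho)%:E); first by rewrite lee_fin lerD2l lerN2.
by apply: arc_ge; rewrite ?fcp ?ge_min ?le_max ?f1p ?lexx ?(ltW rho0) ?orbT.
Qed.

End Concentration.
(** * Finite sets and Hausdorff convergence *)

Section NullSets.
Context {R : realType} {n : nat}.
Implicit Types (A B : set 'rV[R]_n) (x : 'rV[R]_n).
Local Open Scope ereal_scope.

Let hausdorff1_delta_setU1 (delta : R) A x : (0 <= delta)%R ->
  hausdorff1_delta delta (A `|` [set x]) <= hausdorff1_delta delta A.
Proof.
move=> d0; apply: le_ereal_inf_tmp => _ [F [Fd AF] <-].
(* The point x costs nothing as the singleton put in front of the cover F. *)
pose F' i := if i is j.+1 then F j else [set x].
apply: (le_trans (@hausdorff1_delta_le _ _ delta _ F' _ _)).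
- by move=> [|i] //=; rewrite diam_set1 lee_fin.
- by move=> y [/AF[i _ Fy]|->]; [exists i.+1|exists 0%N].
apply: (@nneseries_le_near _ _ _ 1%N) => [i|[//|K] _]; first exact: diam_ge0.
rewrite big_nat_recl//= diam_set1 add0e.
by apply: nneseries_lim_ge => i _ _; exact: diam_ge0.
Qed.

Lemma hausdorff1_setU_finite A B : finite_set B ->
  hausdorff1 (A `|` B) <= hausdorff1 A.
Proof.
move=> /finite_seqP[s ->]; elim: s => [|x s IHs].
  by rewrite (_ : [set` [::]] = set0) ?setU0//; apply/seteqP; split.
apply: le_trans IHs; rewrite (_ : A `|` _ = (A `|` [set` s]) `|` [set x]).
  apply: ge_ereal_sup => _ [d /= d0 <-]; apply: le_trans (hausdorff1_ub _ d0).
  exact: hausdorff1_delta_setU1 (ltW d0).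
apply/seteqP; split=> y /=; rewrite in_cons.
  by move=> [|/predU1P[->|]]; [left; left|right|left; right].
by move=> [[|ys]|->]; [left|right; rewrite ys orbT|right; rewrite eqxx].
Qed.

End NullSets.

Section HausdorffConvergence.
Context {R : realType}.
Local Notation V := 'rV[R]_2.
Implicit Types (A B H K Omega : set V) (x y : V).

(** The distance to the empty set is the diameter of Omega: its being positive
    prevents nonempty sets from converging to the empty one. *)
Lemma diam_gt0 Omega : open Omega -> bounded_set Omega -> Omega !=set0 ->
  0 < fine (diam Omega).
Proof.
move=> oO /bounded_enorm[M OM] [x Ox].
have [e e0 eO] := open_enorm oO Ox.
pose v : V := const_mx 1.
have v0 : 0 < enorm v.
  by have := coord_le_enorm v ord0; rewrite mxE normr1; apply: lt_le_trans.
pose y := x + (e / enorm v) *: v.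
have yx : enorm (y - x) = e.
  by rewrite /y addrC addKr enormZ ger0_norm ?divfK ?gt_eqF// divr_ge0// ltW.
have Oy : Omega y by apply: eO; rewrite yx.
have Ofin : (diam Omega < +oo)%E.
  rewrite (@le_lt_trans _ _ (2 * M)%:E) ?ltry//; apply: diam_le.
    by rewrite mulr_ge0// (le_trans _ (OM _ Ox))// enorm_ge0.
  move=> z w /OM zM /OM wM; rewrite (le_trans (enormD _ _))// enormN.
  by move: zM wM; lra.
have := diam_ub Oy Ox; rewrite yx -(@fineK _ (diam Omega)); last first.
  by rewrite ge0_fin_numE// diam_ge0.
by rewrite lee_fin; exact: lt_le_trans.
Qed.

Lemma compact_dist_bounded A B : compact A -> compact B ->
  exists M, forall x y, A x -> B y -> enorm (x - y) <= M.
Proof.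
move=> /compact_bounded/bounded_enorm[M AM] /compact_bounded/bounded_enorm[N BN].
exists (M + N) => x y /AM xM /BN yN; rewrite (le_trans (enormD _ _))// enormN.
exact: lerD.
Qed.

Lemma dist_le_hdist Omega A B x : compact A -> compact B -> A x ->
  dist Omega x B <= hdist Omega A B.
Proof.
move=> cA cB Ax; have [M ABM] := compact_dist_bounded cA cB.
rewrite le_max; apply/orP; left; apply: ub_le_sup; last by exists x.
have [B0|/set0P[y By]] := eqVneq B set0.
  by exists (fine (diam Omega)) => _ [z _ <-]; rewrite /dist B0 eqxx.
exists M => _ [z Az <-]; rewrite /dist ifF; last by apply/eqP => B0; rewrite B0 in By.
apply: le_trans (ABM _ _ Az By); apply: ge_inf; last by exists y.
by exists 0 => _ [w _ <-]; exact: enorm_ge0.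
Qed.

Lemma hdistC Omega A B : hdist Omega A B = hdist Omega B A.
Proof. by rewrite /hdist maxC. Qed.

Lemma dist_lt_ex Omega x K (e : R) : dist Omega x K < e -> e <= fine (diam Omega) ->
  exists2 y, K y & enorm (x - y) < e.
Proof.
rewrite /dist; case: ifPn => [_ h|/set0P[y Ky] h _]; first by rewrite leNgt h.
have [||_ [z Kz <-]] := inf_adherent (E := [set enorm (x - y) | y in K])
  (eps := e - inf [set enorm (x - y) | y in K]).
- by rewrite subr_gt0.
- split; first by exists (enorm (x - y)), y.
  by exists 0 => _ [z _ <-]; exact: enorm_ge0.
by rewrite addrCA subrr addr0; exists z.
Qed.

Lemma hdist_cvg_near Omega (An : nat -> set V) A (e : R) :
  0 < fine (diam Omega) -> compact A -> (forall k, compact (An k)) ->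
  hdist Omega (An k) A @[k --> \oo] --> (0 : R) -> 0 < e ->
  \forall k \near \oo,
    (forall x, An k x -> exists2 y, A y & enorm (x - y) < e) /\
    (forall x, A x -> exists2 y, An k y & enorm (x - y) < e).
Proof.
move=> diam0 cA cAn hA e0.
pose e' := Num.min e (fine (diam Omega)).
have e'0 : 0 < e' by rewrite lt_min e0.
move/cvgrPdist_lt : hA => /(_ _ e'0); apply: filterS => k.
rewrite sub0r normrN => /(le_lt_trans (ler_norm _)) hk.
have e'e : e' <= e by rewrite /e' ge_min lexx.
have e'd : e' <= fine (diam Omega) by rewrite /e' ge_min lexx orbT.
split=> x Ax.
  have [|y Ay xy] := @dist_lt_ex Omega x A e' _ e'd.
    by apply: le_lt_trans hk; exact: dist_le_hdist.
  by exists y => //; exact: lt_le_trans e'e.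
have [|y Ay xy] := @dist_lt_ex Omega x (An k) e' _ e'd.
  by apply: le_lt_trans hk; rewrite hdistC; exact: dist_le_hdist.
by exists y => //; exact: lt_le_trans e'e.
Qed.

End HausdorffConvergence.
(** * Semicontinuity along an ultrafilter *)

Lemma near_forall_seq (T : Type) (F : set_system T) {FF : Filter F}
    (I : eqType) (s : seq I) (P : I -> T -> Prop) :
  (forall i, i \in s -> \forall k \near F, P i k) ->
  \forall k \near F, forall i, i \in s -> P i k.
Proof.
elim: s => [_|i s IHs Ps]; first exact: nearW.
have Pi : \forall k \near F, P i k by apply: Ps; rewrite mem_head.
have {IHs} Pj : \forall k \near F, forall j, j \in s -> P j k.
  by apply: IHs => j js; apply: Ps; rewrite in_cons js orbT.
apply: filterS2 Pi Pj => k Pik Pjk j.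
by rewrite in_cons => /predU1P[->//|/Pjk].
Qed.

(** G stands for the part of K outside H in U; of the convergence only the
    behaviour of K_k and H_k near single points of G matters. *)
Section LimitPoints.
Context {R : realType} {n : nat}.
Local Notation V := 'rV[R]_n.
Variables (W : set_system nat).
Hypothesis UW : UltraFilter W.
Variables (Hn Kn : nat -> set V) (G U : set V) (c : R) (m : nat).
Hypothesis Kn_closed : forall k, closed (Kn k).
Hypothesis G_far : forall x, G x -> exists2 s, 0 < s &
  disc x s `<=` U /\ \forall k \near W, forall y, Hn k y -> s < enorm (y - x).
Hypothesis G_limit : forall x (e : R), G x -> 0 < e ->
  \forall k \near W, exists2 y, Kn k y & enorm (y - x) < e.
Hypothesis few_components : forall k,
  (components_disjoint_from (Kn k) (Hn k) #<= `I_m)%card.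
Hypothesis measure_le : \forall k \near W,
  (hausdorff1 ((Kn k `\` Hn k) `&` U) <= c%:E)%E.
Implicit Types x y z p : V.

(** These are the points where concentration applies: components of K_k of size
    at least r0 come arbitrarily close to x. *)
Definition persistent x := exists2 r0, 0 < r0 & forall e, 0 < e ->
  \forall k \near W, exists2 y, Kn k y /\ enorm (y - x) < e &
    exists2 z, connected_component (Kn k) y z & r0 <= enorm (z - y).

(** Around m + 1 points that are not persistent, some K_k would have components
    contained in disjoint small balls that H_k does not meet: m + 1 different
    components disjoint from H_k. *)
Lemma finite_not_persistent : finite_set (G `&` ~` persistent).
Proof.
apply: contrapT => /(@infinite_set_fset _ _ m.+1)[B0 BG0 mB].
have [B [uB BG {}mB]] : exists B : seq V, [/\ uniq B,
    forall x, x \in B -> G x /\ ~ persistent x & (m < size B)%N].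
  by exists (finmap.enum_fset B0); split=> //; exact: finmap.fset_uniq.
have Bs x : x \in B -> exists2 s, 0 < s &
    disc x s `<=` U /\ \forall k \near W, forall y, Hn k y -> s < enorm (y - x).
  by move=> /BG[/G_far Gx].
(* The components will lie within 2 r of the points of B, with r at most a
   quarter of the distances between these points and below half of their
   distances to H_k. *)
have [r0 r00 Br] : exists2 r0, 0 < r0 & forall i, i \in [seq (x, y) | x <- B, y <- B] ->
    i.1 <> i.2 -> 4 * r0 <= enorm (i.1 - i.2).
  have [i _|r r00 rB] := @exists_lower_bound R _
    (fun i : V * V => if i.1 == i.2 then 1 else enorm (i.1 - i.2))
    [seq (x, y) | x <- B, y <- B].
    case: ifPn => // ii; rewrite lt_neqAle enorm_ge0 andbT eq_sym.
    by apply: contra_neq ii => /enorm_eq0/eqP; rewrite subr_eq0 => /eqP.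
  exists (r / 4); first by rewrite divr_gt0.
  by move=> i /rB + /eqP/negPf ii; rewrite ii mulrC divfK.
have [r1 r10 Br1] : exists2 r1, 0 < r1 & forall x, x \in B -> \forall k \near W,
    forall y, Hn k y -> 2 * r1 < enorm (y - x).
  have /choice[s sP] : forall x : V, exists s, x \in B -> 0 < s /\
      \forall k \near W, forall y, Hn k y -> s < enorm (y - x).
    move=> x; have [xB|nxB] := boolP ((x : V) \in B); last by exists 0.
    by have [s s0 [_ sH]] := Bs x xB; exists s.
  have [r rpos rs] := @exists_lower_bound R _ s B (fun x xB => (sP x xB).1).
  exists (r / 2); first by rewrite divr_gt0.
  move=> x xB; apply: filterS (sP x xB).2 => k h y /h.
  by rewrite mulrC divfK//; apply: le_lt_trans; exact: rs.
pose r := Num.min r0 r1.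
have r_gt0 : 0 < r by rewrite lt_min r00.
have rr0 : r <= r0 by rewrite /r ge_min lexx.
have rr1 : r <= r1 by rewrite /r ge_min lexx orbT.
have small : \forall k \near W, forall x, x \in B -> exists2 y,
    Kn k y /\ enorm (y - x) < r &
    forall z, connected_component (Kn k) y z -> enorm (z - y) < r.
  apply: near_forall_seq => x xB; have [Gx nx] := BG _ xB.
  have [e [e0 ne]] : exists e, 0 < e /\ ~ \forall k \near W, exists2 y,
      Kn k y /\ enorm (y - x) < e &
      exists2 z, connected_component (Kn k) y z & r <= enorm (z - y).
    apply: contrapT => H; apply: nx; exists r => // e e0.
    by apply: contrapT => He; apply: H; exists e.
  have er0 : 0 < Num.min e r by rewrite lt_min e0.
  have near_small : \forall k \near W, ~ exists2 y, Kn k y /\ enorm (y - x) < e &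
      exists2 z, connected_component (Kn k) y z & r <= enorm (z - y).
    by have [//|] := in_ultra_setVsetC [set k | exists2 y,
      Kn k y /\ enorm (y - x) < e &
      exists2 z, connected_component (Kn k) y z & r <= enorm (z - y)] UW.
  apply: filterS2 near_small (G_limit Gx er0) => k nk [y Ky].
  rewrite lt_min => /andP[ye yr]; exists y => // z yz.
  by rewrite ltNge; apply/negP => rz; apply: nk; exists y => //; exists z.
have far : \forall k \near W, forall x, x \in B -> forall y, Hn k y ->
    2 * r1 < enorm (y - x) by exact: near_forall_seq.
have [k [kfar ksmall]] := filter_ex (filterI far small).
have /choice[f fP] : forall x : V, exists y, x \in B ->
    (Kn k y /\ enorm (y - x) < r) /\
    forall z, connected_component (Kn k) y z -> enorm (z - y) < r.
  move=> x; have [xB|nxB] := boolP ((x : V) \in B); last by exists 0.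
  by have [y] := ksmall x xB; exists y.
pose C x := connected_component (Kn k) (f x).
have /pcard_leP/unsquash g := few_components k.
have CB x : x \in B -> components_disjoint_from (Kn k) (Hn k) (C x).
  move=> xB; have [[Kf fx] fr] := fP x xB.
  split; first by exists (f x).
  rewrite -subset0 => z [Cz Hz]; have := kfar x xB z Hz.
  by have := fr z Cz; have := enorm_triangle (f x) z x; lra.
have Cinj x y : x \in B -> y \in B -> C x = C y -> x = y.
  move=> xB yB Cxy; apply: contrapT => xy.
  have := Br (x, y) _ xy; rewrite allpairs_f//= => /(_ isT).
  have [[_ fx] fr] := fP x xB; have [[Kfy fy] _] := fP y yB.
  have := fr (f y); rewrite -/(C x) Cxy => /(_ (connected_component_refl Kfy)).
  have := enorm_triangle (f x) x y; have := enorm_triangle (f y) (f x) y.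
  by rewrite (enorm_distC x (f x)) (enorm_distC (f x) (f y)); lra.
have : uniq [seq g (C x) | x <- B].
  rewrite map_inj_in_uniq// => x y xB yB gxy; apply: Cinj => //.
  exact: (@inj _ _ _ g) (mem_set (CB _ xB)) (mem_set (CB _ yB)) gxy.
move=> /(@uniq_leq_size _ _ (iota 0 m)); rewrite size_map size_iota => sz.
have : (m < m)%N.
  apply: leq_trans mB _; apply: sz => _ /mapP[x xB ->].
  by rewrite mem_iota add0n; exact: (@funS _ _ _ `I_m g (C x) (CB _ xB)).
by rewrite ltnn.
Qed.

(** The discs do not depend on k, so that they can be used in a covering of the
    limit set; the factor theta pays for replacing centres by their limit. *)
Definition charged (theta : R) : set (V * R) := [set d |
  [/\ 0 < d.2, disc d.1 d.2 `<=` U & \forall k \near W,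
    (forall y, Hn k y -> ~ disc d.1 d.2 y) /\
    ((2 * d.2 / theta)%:E <= hausdorff1 (Kn k `&` disc d.1 d.2))%E]].

Lemma charged_sum theta (s : seq (V * R)) : 1 < theta ->
  (forall d, d \in s -> charged theta d) -> pairwise far_apart s ->
  \sum_(d <- s) 2 * d.2 <= theta * c.
Proof.
move=> theta1 sC s_far; have theta0 : 0 < theta := lt_trans ltr01 theta1.
have near_s : \forall k \near W, forall d, d \in s ->
    (forall y, Hn k y -> ~ disc d.1 d.2 y) /\
    ((2 * d.2 / theta)%:E <= hausdorff1 (Kn k `&` disc d.1 d.2))%E.
  by apply: near_forall_seq => d /sC[].
have [k [ks kc]] := filter_ex (filterI near_s measure_le).
rewrite mulrC -ler_pdivrMr// mulr_suml -lee_fin -sumEFin.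
apply: le_trans kc.
apply: le_trans (sum_hausdorff1_discs ((Kn k `\` Hn k) `&` U) s_far).
rewrite big_seq [leRHS]big_seq; apply: lee_sum => d ds.
have [dH] := ks d ds; move=> /le_trans; apply; apply: le_hausdorff1.
move=> y [Ky dy]; split=> //; split; last by have [_ + _] := sC d ds; exact.
by split=> // Hy; exact: dH dy.
Qed.

(** Concentration applied to K_k provides centres p_k of discs of radius r / 2 in
    which K_k has length at least r.  The centres converge to some q along W, and
    the disc of centre q and radius theta r / 2 contains those of centre p_k for
    most k. *)
Lemma charged_fine theta x (e : R) : 1 < theta -> theta <= 2 ->
  G x -> persistent x -> 0 < e -> exists d, [/\ charged theta d, 0 < d.2,
    enorm (x - d.1) + d.2 <= e & enorm (x - d.1) <= 2 * d.2].
Proof.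
move=> theta1 theta2 Gx [r0 r00 xr0] e0.
have [s s0 [sU sH]] := G_far Gx.
pose r := Num.min r0 (Num.min (s / 4) (e / 4)).
have r_gt0 : 0 < r by rewrite !lt_min r00 !divr_gt0.
have rr0 : r <= r0 by rewrite /r ge_min lexx.
have rs : r <= s / 4 by rewrite /r !ge_min lexx !orbT.
have re : r <= e / 4 by rewrite /r !ge_min lexx !orbT.
have inU y : enorm (y - x) <= s -> U y by exact: sU.
have r2 : 0 < r / 2 by rewrite divr_gt0.
have near_p : \forall k \near W, exists2 p, enorm (p - x) <= r &
    (r%:E <= hausdorff1 (Kn k `&` disc p (r / 2)))%E.
  apply: filterS3 (xr0 _ r2) sH measure_le => k [y [Ky yx] [z yz zr]] kH kc.
  pose C := connected_component (Kn k) y.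
  have CK : C `<=` Kn k by exact: connected_component_sub.
  have [||||||p [py pr]] := @hausdorff1_disc_ge _ _ C y z r (2 * r) _ _ _ yz r_gt0.
  - exact: component_closed.
  - exact: component_connected.
  - exact: connected_component_refl.
  - exact: le_trans zr.
  - by lra.
  - apply: le_lt_trans (ltry c); apply: le_trans kc; apply: le_hausdorff1.
    move=> w [/CK Kw yw].
    have wx : enorm (w - x) <= s.
      by have := enorm_triangle y w x; move: yw; rewrite /disc /=; lra.
    split; last exact: inU.
    by split=> // /kH; rewrite ltNge wx.
  exists p; first by have := enorm_triangle y p x; lra.
  apply: le_trans pr _; apply: le_hausdorff1 => w [/CK Kw pw]; by split.
have /choice[p pP] : forall k, exists p, (exists2 p, enorm (p - x) <= r &
      (r%:E <= hausdorff1 (Kn k `&` disc p (r / 2)))%E) ->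
    enorm (p - x) <= r /\ (r%:E <= hausdorff1 (Kn k `&` disc p (r / 2)))%E.
  move=> k; have [[p px pr]|np] := pselect (exists2 p, enorm (p - x) <= r &
      (r%:E <= hausdorff1 (Kn k `&` disc p (r / 2)))%E); first by exists p.
  by exists 0.
have [|q pq] := @ultra_limit_enorm _ W UW _ _ p x r.
  by apply: filterS near_p => k /pP[].
have qx : enorm (q - x) <= r.
  apply/ler_addgt0Pr => t t0.
  have [k [/pP[px _] kq]] := filter_ex (filterI near_p (pq t t0)).
  by have := enorm_triangle (p k) q x; rewrite (enorm_distC q (p k)); lra.
have rho0 : 0 < theta * r / 2 by rewrite divr_gt0// mulr_gt0// (lt_trans ltr01).
have rtheta : r <= theta * r by rewrite ler_peMl ?(ltW r_gt0)// ltW.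
have rtheta2 : theta * r <= 2 * r by rewrite ler_wpM2r// ltW.
have disc_s y : disc q (theta * r / 2) y -> enorm (y - x) <= s.
  by rewrite /disc /= => yq; have := enorm_triangle q y x; lra.
exists (q, theta * r / 2); split=> //=; last 2 first.
- by rewrite enorm_distC; lra.
- by rewrite enorm_distC; lra.
split=> //=; first by move=> y /disc_s /inU.
have small0 : 0 < theta * r / 2 - r / 2.
  by rewrite subr_gt0 ltr_pM2r// ltr_pMl.
apply: filterS3 near_p (pq _ small0) sH => k /pP[_ pr] kq kH; split.
  by move=> y /kH + /disc_s; rewrite ltNge => /negP.
rewrite (_ : 2 * _ / theta = r); last first.
  by field; rewrite gt_eqF// (lt_trans ltr01).
apply: le_trans pr _; apply: le_hausdorff1 => w [Kw pw]; split=> //.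
by move: pw; rewrite /disc /=; have := enorm_triangle (p k) w q; lra.
Qed.

Lemma hausdorff1_limit_le : (hausdorff1 G <= c%:E)%E.
Proof.
have [k kc] := filter_ex measure_le.
have c0 : 0 <= c by rewrite -lee_fin (le_trans (hausdorff1_ge0 _) kc).
apply: (@le_trans _ _ (hausdorff1 (G `&` persistent))).
  rewrite -{1}[G](setUIDK _ persistent) setDE.
  apply: hausdorff1_setU_finite; exact: finite_not_persistent.
apply/lee_addgt0Pr => e e0; rewrite -EFinD.
(* theta is at most 2 and theta * c is at most c + e, also when c = 0. *)
pose theta := 1 + Num.min 1 (e / (c + 1)).
have c1 : 0 < c + 1 by rewrite ltr_wpDl.
have theta1 : 1 < theta by rewrite ltrDl lt_min ltr01 divr_gt0.
have theta2 : theta <= 2 by rewrite /theta lerD2l ge_min lexx.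
apply: (@le_trans _ _ (theta * c)%:E); last first.
  rewrite lee_fin /theta mulrDl mul1r lerD2l.
  rewrite (@le_trans _ _ (e / (c + 1) * (c + 1)))//; last by rewrite divfK ?gt_eqF.
  by apply: ler_pM => //; rewrite ?lerDl// ?ge_min ?lexx ?orbT// le_min ler01 divr_ge0 ?ltW.
apply: (@vitali_hausdorff1 _ _ (charged theta)).
  by move=> s; exact: charged_sum.
by move=> x t [Gx px] t0; exact: charged_fine.
Qed.

End LimitPoints.

Lemma limn_einf_frequently (R : realType) (h : nat -> \bar R) (c : \bar R) :
  (limn_einf h < c)%E -> forall N, exists2 k, (N <= k)%N & (h k < c)%E.
Proof.
move=> hc N.
have : (ereal_inf (sdrop h N) < c)%E.
  apply: le_lt_trans hc; rewrite limn_einf_lim (cvg_lim _ (@cvg_einfs_sup _ h))//.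
  by apply: ereal_sup_ubound; exists N.
by move=> /ereal_inf_lt[_ [k /= Nk <-] kc]; exists k.
Qed.

(** The ultrafilter plays the role of a subsequence along which P holds. *)
Lemma ultrafilter_frequently (P : set nat) :
  (forall N, exists2 k, (N <= k)%N & P k) ->
  exists W, [/\ UltraFilter W, \oo `<=` W & \forall k \near W, P k].
Proof.
move=> Pfreq; have PF : ProperFilter (within P \oo).
  apply: Build_ProperFilter => -[N _ NP].
  by have [k /NP] := Pfreq N; exact.
have [W [UW PW]] := ultraFilterLemma PF.
exists W; split=> //; last by apply: PW; exact: withinT.
by move=> A oA; apply: PW; exact: cvg_within oA.
Qed.

Theorem proposition3p6 (R : realType) (Omega : set 'rV[R]_2)
    (Omega_bounded : bounded_set Omega) (Omega_connected : connected Omega)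
    (Omega_open : open Omega) (Omega_lipschitz : lipschitz_boundary Omega)
    (Hn Kn : nat -> set 'rV[R]_2) (H K : set 'rV[R]_2)
    (Hn_compact : forall n, compact_subsets (closure Omega) (Hn n))
    (Kn_compact : forall n, compact_subsets (closure Omega) (Kn n))
    (H_compact : compact_subsets (closure Omega) H)
    (K_compact : compact_subsets (closure Omega) K)
    (Hn_cvg : hdist Omega (Hn n) H @[n --> \oo] --> (0 : R))
    (Kn_cvg : hdist Omega (Kn n) K @[n --> \oo] --> (0 : R))
    (components_bounded : exists m : nat, forall n : nat,
       (components_disjoint_from (Kn n) (Hn n) #<= `I_m)%card)
    (U : set 'rV[R]_2) (U_open : open U) (U_sub : U `<=` Omega) :
  (hausdorff1 ((K `\` H) `&` U)
     <= limn_einf (fun n => hausdorff1 ((Kn n `\` Hn n) `&` U)))%E.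
Proof.
have [m few] := components_bounded.
set h := fun k => _; set G := (K `\` H) `&` U.
have closedV (A : set 'rV[R]_2) : compact A -> closed A.
  by apply: compact_closed; exact: norm_hausdorff.
have diam0 x : K x -> 0 < fine (diam Omega).
  move=> /(K_compact.2 x) clx; apply: diam_gt0 => //; apply/set0P/eqP => Omega0.
  by move: clx; rewrite Omega0 closure0.
have bound c : (limn_einf h < c%:E)%E -> (hausdorff1 G <= c%:E)%E.
  move=> /limn_einf_frequently/ultrafilter_frequently[W [UW ooW hc]].
  apply: (@hausdorff1_limit_le _ _ W UW Hn Kn G U c m) => //.
  - by move=> k; apply: closedV; have [] := Kn_compact k.
  - move=> x [[Kx nHx] Ux].
    have [s s0 sU] := open_enorm U_open Ux.
    have [t t0 tH] := open_enorm (closed_openC (closedV _ H_compact.1)) nHx.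
    pose r := Num.min s (t / 2).
    have r0 : 0 < r by rewrite lt_min s0 divr_gt0.
    have rs : r <= s by rewrite /r ge_min lexx.
    have rt : r <= t / 2 by rewrite /r ge_min lexx orbT.
    exists r => //; split; first by move=> y yr; apply: sU; exact: le_trans yr rs.
    have := hdist_cvg_near (diam0 _ Kx) H_compact.1 (fun k => (Hn_compact k).1) Hn_cvg r0.
    move=> /ooW; apply: filterS => k [kH _] y /kH[z Hz yz].
    rewrite ltNge; apply/negP => yx; apply: (tH z) => //.
    by have := enorm_triangle y z x; rewrite (enorm_distC z y); lra.
  - move=> x e [[Kx _] _] e0.
    have := hdist_cvg_near (diam0 _ Kx) K_compact.1 (fun k => (Kn_compact k).1) Kn_cvg e0.
    move=> /ooW; apply: filterS => k [_ kK]; have [y Ky xy] := kK x Kx.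
    by exists y => //; rewrite enorm_distC.
  - by apply: filterS hc => k; exact: ltW.
case: (limn_einf h) bound => [l bound|_|bound].
- by apply/lee_addgt0Pr => e e0; apply: bound; rewrite lte_fin ltrDl.
- by rewrite leey.
by have := le_trans (hausdorff1_ge0 G) (bound (-1) (ltNyr _)); rewrite lee_fin ler0N1.
Qed.
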